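(* The normal crossing divisors are the only Abelian linear free divisors: if $D\subset V=\mathbb{A}^n_{\mathbb{C}}$ is a linear free divisor whose associated group $G$ is Abelian, then there are linear coordinates $x_1,\dots,x_n$ on $V$ such that $D=\{x_1\cdots x_n=0\}$; and conversely these normal crossing divisors are Abelian linear free divisors.
   Context: Let $V=\mathbb{A}^n_{\mathbb{C}}$ and $D\subset V$ a reduced hypersurface. $\mathrm{Der}(-\log D)$ is the sheaf of vector fields $\delta$ with $\delta(f)\in(f)$ for a local reduced equation $f$ of $D$. $D$ is a linear free divisor if $\mathrm{Der}(-\log D)$ is freely generated over $\mathcal{O}_V$ by globally defined linear vector fields $\sum a_{ij}x_j\partial/\partial x_i$, $a_{ij}\in\mathbb{C}$. The associated group $G$ is the largest connected subgroup of $\mathrm{GL}(V)$ preserving $D$; $D$ is called Abelian if $G$ is Abelian. *)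

(* Defs.v *)
From HB Require Import structures.
From mathcomp Require Import all_boot all_order all_algebra.
(* mpoly has to be imported before topology: in the other order the notation
   levels clash. *)
From mathcomp Require Import complex mpoly.
From mathcomp Require Import all_classical reals topology normedtype.

Set Implicit Arguments.
Unset Strict Implicit.
Unset Printing Implicit Defensive.

Import Order.TTheory GRing.Theory Num.Theory numFieldNormedType.Exports.
Local Open Scope classical_set_scope.
Local Open Scope ring_scope.

(* K stands for the field of complex numbers R[i], R : realType.  Only the
   topology attached to the norm of K is used, so that for K = R[i] matrices
   carry the usual (Euclidean) topology. *)

Definition zero_locus (K : numClosedFieldType) (n : nat) (f : {mpoly K[n]}) :
    set 'cV[K]_n :=
  [set v | f.@[fun i => v i 0] = 0].

Definition mdvd (K : numClosedFieldType) (n : nat) (f g : {mpoly K[n]}) : Prop :=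
  exists h : {mpoly K[n]}, g = h * f.

(* K[x_1, ..., x_n]/(f) has no nonzero nilpotent element. *)
Definition reduced_mpoly (K : numClosedFieldType) (n : nat)
    (f : {mpoly K[n]}) : Prop :=
  forall (g : {mpoly K[n]}) (k : nat), mdvd f (g ^+ k) -> mdvd f g.

(* D is the reduced hypersurface f = 0; 1 < msize f says that f is neither
   zero nor constant.  A hypersurface of affine space always has such a global
   equation, since the polynomial ring is factorial. *)
Definition reduced_equation (K : numClosedFieldType) (n : nat)
    (D : set 'cV[K]_n) (f : {mpoly K[n]}) : Prop :=
  [/\ (1 < msize f)%N, reduced_mpoly f & D = zero_locus f].

(* delta : 'cV[{mpoly K[n]}]_n is the vector field
   \sum_i delta_i d/dx_i on affine n-space. *)
Definition vf_apply (K : numClosedFieldType) (n : nat)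
    (delta : 'cV[{mpoly K[n]}]_n) (f : {mpoly K[n]}) : {mpoly K[n]} :=
  \sum_(i < n) delta i 0 * mderiv i f.

(* The module of global sections of the sheaf Der(-log D), D = {f = 0}.  The
   sheaf is coherent on an affine space, so it is freely generated by given
   global sections if and only if this module is. *)
Definition Der_log (K : numClosedFieldType) (n : nat) (f : {mpoly K[n]}) :
    set 'cV[{mpoly K[n]}]_n :=
  [set delta | mdvd f (vf_apply delta f)].

Definition linear_vf (K : numClosedFieldType) (n : nat) (A : 'M[K]_n) :
    'cV[{mpoly K[n]}]_n :=
  \col_(i < n) \sum_(j < n) A i j *: 'X_j.

Definition freely_generated_by (K : numClosedFieldType) (n m : nat)
    (M : set 'cV[{mpoly K[n]}]_n) (delta : 'I_m -> 'cV[{mpoly K[n]}]_n) : Prop :=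
  M = [set eta | exists c : 'I_m -> {mpoly K[n]},
                   eta = \sum_(k < m) c k *: delta k] /\
  forall c : 'I_m -> {mpoly K[n]},
    \sum_(k < m) c k *: delta k = 0 -> forall k, c k = 0.

Definition linear_free_divisor (K : numClosedFieldType) (n : nat)
    (D : set 'cV[K]_n) : Prop :=
  exists2 f : {mpoly K[n]}, reduced_equation D f &
    exists (m : nat) (A : 'I_m -> 'M[K]_n),
      freely_generated_by (Der_log f) (fun k => linear_vf (A k)).

Definition GL_subgroup (K : numClosedFieldType) (n : nat)
    (H : set 'M[K]_n) : Prop :=
  [/\ forall A, H A -> A \in unitmx,
      H 1%:M,
      forall A B, H A -> H B -> H (A *m B) &
      forall A, H A -> H (invmx A)].

Definition preserves (K : numClosedFieldType) (n : nat)
    (H : set 'M[K]_n) (D : set 'cV[K]_n) : Prop :=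
  forall A, H A -> (fun v => A *m v) @` D = D.

Definition connected_GL_subgroup_preserving (K : numClosedFieldType) (n : nat)
    (D : set 'cV[K]_n) (H : set 'M[K]_n) : Prop :=
  [/\ GL_subgroup H, connected H & preserves H D].

(* G is the largest connected subgroup of GL_n(K) preserving D. *)
Definition associated_group (K : numClosedFieldType) (n : nat)
    (D : set 'cV[K]_n) (G : set 'M[K]_n) : Prop :=
  connected_GL_subgroup_preserving D G /\
  forall H, connected_GL_subgroup_preserving D H -> H `<=` G.

Definition abelian_divisor (K : numClosedFieldType) (n : nat)
    (D : set 'cV[K]_n) : Prop :=
  exists2 G : set 'M[K]_n, associated_group D G &
    forall A B, G A -> G B -> A *m B = B *m A.

(* The rows of the invertible matrix P are the linear coordinates
   x_1, ..., x_n, that is, x_i(v) = (P *m v) i 0. *)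
Definition normal_crossing_divisor (K : numClosedFieldType) (n : nat)
    (D : set 'cV[K]_n) : Prop :=
  exists2 P : 'M[K]_n, P \in unitmx &
    D = [set v | \prod_(i < n) (P *m v) i 0 = 0].

(* Main.v *)
Require Import Defs.
From HB Require Import structures.
From mathcomp Require Import all_boot all_order all_algebra.
From mathcomp Require Import complex mpoly.
From mathcomp Require Import all_classical reals topology normedtype.
From mathcomp Require Import sequences exp.

(** If D = {f = 0} is an Abelian linear free divisor, let g be the space of
    matrices A with (A x) . grad f = lam f for a constant lam.  The semisimple
    and nilpotent parts of A in g act on f separately, and their exponentials
    lie in the associated group G; hence g is commutative because G is.
    Der(-log D) being generated by linear fields has two consequences:
    g p = K^n as soon as f(p) <> 0 (apply it to the logarithmic fields
    f d/dx_i), and no nonzero constant field is logarithmic (linear fields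
    vanish at 0).  By the first one, a commutative g is a unital subalgebra of
    the matrix algebra.  If N in g is nilpotent and w = N p, then at every x
    with f(x) <> 0 we have w = N C x with C in g, and N C is nilpotent, so that
    the derivative of f in the direction w vanishes; by the second consequence
    w = 0 and N = 0.  So g consists of commuting diagonalizable matrices, and
    by transitivity it is a full torus; f is then a monomial in the
    eigen-coordinates, all of which occur, again by the second consequence.

    For the converse, the connected group preserving the coordinate hyperplanes
    permutes them, and being diagonal is an open and closed condition on
    monomial matrices. *)

Set Implicit Arguments.
Unset Strict Implicit.
Unset Printing Implicit Defensive.

Import Order.TTheory GRing.Theory Num.Theory numFieldNormedType.Exports.
Local Open Scope classical_set_scope.
Local Open Scope ring_scope.

(** * Polynomials as functions, and the chain rule *)

Lemma mpoly_ring_ind (n : nat) (R : comNzRingType) (P : {mpoly R[n]} -> Prop) :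
  (forall c, P c%:MP) -> (forall i, P 'X_i) ->
  (forall p q, P p -> P q -> P (p + q)) ->
  (forall p q, P p -> P q -> P (p * q)) -> forall p, P p.
Proof.
move=> PC PX PD PM p; rewrite (mpolyE p).
apply: big_ind => [||m _]; [by rewrite -mpolyC0|exact: PD|].
rewrite -mul_mpolyC; apply: (PM) => //; rewrite mpolyXE_id.
apply: big_ind => [||i _]; [by rewrite -mpolyC1|exact: PM|].
elim: (m i) => [|k IHk]; first by rewrite expr0 -mpolyC1.
by rewrite exprS; apply: (PM).
Qed.

Lemma submm n (m : 'X_{1..n}) : (m - m)%MM = 0%MM.
Proof. by rewrite -{1}[m]add0m addmK. Qed.

(** The chain rule: a derivation that kills constants is determined by its values on the variables.
    It serves both for differentiating [f] along polynomial curves and for linear derivations under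
    a linear change of variables. *)
Lemma derivation_mmap (n : nat) (R S : comNzRingType) (h : {rmorphism R -> S})
    (v : 'I_n -> S) (d : S -> S) :
  {morph d : x y / x + y} -> (forall x y, d (x * y) = d x * y + x * d y) ->
  (forall c, d (h c) = 0) ->
  forall p : {mpoly R[n]},
    d (mmap h v p) = \sum_(i < n) mmap h v p^`M(i) * d (v i).
Proof.
move=> dD dM dC; elim/mpoly_ring_ind => [c|i|p q IHp IHq|p q IHp IHq].
- rewrite mmapC dC big1 // => i _; by rewrite mderivC mmap0 mul0r.
- rewrite mmapX mmap1U (bigD1 i) //= big1 => [|j jNi]; rewrite mderivX mmapZ.
    by rewrite mnm1E eqxx submm mmapX mmap11 rmorph1 !mul1r addr0.
  by rewrite mnm1E eq_sym (negPf jNi) rmorph0 !mul0r.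
- rewrite mmapD dD IHp IHq -big_split /=; apply: eq_bigr => i _.
  by rewrite mderivD mmapD mulrDl.
- rewrite rmorphM dM IHp IHq mulr_suml mulr_sumr -big_split /=.
  apply: eq_bigr => i _; rewrite mderivM rmorphD !rmorphM mulrDl /=.
  by rewrite -!mulrA [d (v i) * _]mulrC.
Qed.

Lemma horner_mmap (n : nat) (R : comNzRingType) (q : 'I_n -> {poly R})
    (p : {mpoly R[n]}) (t : R) :
  (mmap polyC q p).[t] = p.@[fun i => (q i).[t]].
Proof.
elim/mpoly_ring_ind: p => [c|i|p q' IHp IHq|p q' IHp IHq].
- by rewrite mmapC mevalC hornerC.
- by rewrite mmapX mmap1U mevalXU.
- by rewrite mmapD mevalD hornerD IHp IHq.
- by rewrite rmorphM mevalM hornerM IHp IHq.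
Qed.

Lemma poly_eq0_on_nat (K : numDomainType) (q : {poly K}) :
  (forall k : nat, q.[k%:R] = 0) -> q = 0.
Proof.
move=> q0; apply: (@roots_geq_poly_eq0 _ _ [seq k%:R | k <- iota 0 (size q)]).
- by apply/allP => _ /mapP[k _ ->]; rewrite /root q0.
- by rewrite map_inj_uniq ?iota_uniq // => x y /eqP; rewrite eqr_nat => /eqP.
- by rewrite size_map size_iota.
Qed.

(** Restricting [p] to the line through [v] in the direction of the i-th axis gives a polynomial in
    one variable that vanishes at all naturals, hence is zero; its derivative at 0 is the partial
    derivative at [v]. *)
Lemma mderiv_meval0 (K : numDomainType) (n : nat) (p : {mpoly K[n]}) i :
  (forall v, p.@[v] = 0) -> forall v, p^`M(i).@[v] = 0.
Proof.
move=> p0 v; pose q j : {poly K} := (v j)%:P + (i == j)%:R *: 'X.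
have /(congr1 (fun r : {poly K} => r^`())) : mmap polyC q p = 0.
  by apply: poly_eq0_on_nat => k; rewrite horner_mmap p0.
rewrite derivC (@derivation_mmap _ _ _ polyC q (@deriv K)); last 3 first.
- exact: derivD.
- exact: derivM.
- exact: derivC.
rewrite (bigD1 i) //= big1 ?addr0 => [|j jNi]; last first.
  by rewrite eq_sym in jNi; rewrite /q derivD derivZ derivX derivC (negPf jNi)
    scale0r addr0 mulr0.
rewrite /q eqxx scale1r derivD derivX derivC add0r mulr1.
move/(congr1 (fun r => r.[0])); rewrite horner0 horner_mmap => <-.
by apply: meval_eq => j; rewrite hornerD hornerC hornerZ hornerX mulr0 addr0.
Qed.

Lemma mderiv_eq0 (K : numDomainType) (n : nat) (p : {mpoly K[n]}) :
  (forall i, p^`M(i) = 0) -> p = (p@_0)%:MP.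
Proof.
move=> p0; apply/mpolyP => m; rewrite mcoeffC.
have [->|m0] := eqVneq m 0%MM; first by rewrite mulr1.
rewrite mulr0.
have [i mi] : exists i, m i != 0%N.
  apply/existsP; apply: contra_neqT m0 => /existsPn m0.
  by apply/mnmP => i; rewrite mnm0E; apply/eqP/negPn/m0.
have /(congr1 (mcoeff (m - U_(i))%MM)) := p0 i.
rewrite mcoeff_deriv mcoeff0 submK ?lep1mP //.
by move/eqP; rewrite mulrn_eq0 /= => /eqP.
Qed.

(** Induction on a bound for the degree: the partial derivatives vanish as functions and have
    smaller degree, so they are zero, and in characteristic 0 this makes [p] constant. *)
Lemma mpoly_eq0_meval (K : numDomainType) (n : nat) (p : {mpoly K[n]}) :
  (forall v, p.@[v] = 0) -> p = 0.
Proof.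
move: (msize p) (@msize_mdeg_ge n _ p) => k; elim: k p => [|k IHk] p pk p0.
  by apply/mpolyP => m; rewrite mcoeff0 memN_msupp_eq0 // pk.
have dp i : p^`M(i) = 0.
  apply: IHk; last exact: mderiv_meval0.
  move=> m km; rewrite -mcoeff_eq0 mcoeff_deriv memN_msupp_eq0 ?mul0rn //.
  by rewrite pk // mdegD mdeg1 addn1.
have := p0 (fun=> 0); rewrite (mderiv_eq0 dp) mevalC => ->.
by rewrite mpolyC0.
Qed.

(** * Polynomial vector fields and linear substitutions *)

Section VectorFields.
Variables (K : numClosedFieldType) (n : nat).
Implicit Types (f g p q : {mpoly K[n]}) (A B : 'M[K]_n).
Implicit Types (delta : 'cV[{mpoly K[n]}]_n).

Lemma vf_applyD delta : {morph vf_apply delta : p q / p + q}.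
Proof.
move=> p q; rewrite /vf_apply -big_split /=; apply: eq_bigr => i _.
by rewrite mderivD mulrDr.
Qed.

Lemma vf_applyZ delta c p : vf_apply delta (c *: p) = c *: vf_apply delta p.
Proof.
rewrite /vf_apply scaler_sumr; apply: eq_bigr => i _.
by rewrite mderivZ scalerAr.
Qed.

Lemma vf_apply0 delta : vf_apply delta 0 = 0.
Proof. by rewrite -[X in vf_apply _ X](scale0r 0) vf_applyZ scale0r. Qed.

Lemma vf_applyC delta c : vf_apply delta c%:MP = 0.
Proof. by rewrite /vf_apply big1 // => i _; rewrite mderivC mulr0. Qed.

Lemma vf_applyM delta p q :
  vf_apply delta (p * q) = vf_apply delta p * q + p * vf_apply delta q.
Proof.
rewrite /vf_apply mulr_suml mulr_sumr -big_split /=.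
by apply: eq_bigr => i _; rewrite mderivM mulrDr !mulrA [p * delta i 0]mulrC.
Qed.

Lemma vf_applyXU delta i : vf_apply delta 'X_i = delta i 0.
Proof.
rewrite /vf_apply (bigD1 i) //= big1 => [|j jNi]; rewrite mderivX mnm1E.
  by rewrite eqxx scale1r submm mpolyX0 mulr1 addr0.
by rewrite eq_sym (negPf jNi) scale0r mulr0.
Qed.

Lemma vf_applyDl d1 d2 f : vf_apply (d1 + d2) f = vf_apply d1 f + vf_apply d2 f.
Proof.
rewrite /vf_apply -big_split /=; apply: eq_bigr => i _.
by rewrite mxE mulrDl.
Qed.

Lemma vf_applyZl p delta f : vf_apply (p *: delta) f = p * vf_apply delta f.
Proof.
by rewrite /vf_apply mulr_sumr; apply: eq_bigr => i _; rewrite mxE mulrA.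
Qed.

Lemma linear_vfD A B : linear_vf (A + B) = linear_vf A + linear_vf B.
Proof.
apply/colP => i; rewrite !mxE -big_split /=; apply: eq_bigr => j _.
by rewrite mxE scalerDl.
Qed.

Lemma linear_vfZ c A : linear_vf (c *: A) = c%:MP *: linear_vf A.
Proof.
apply/colP => i; rewrite !mxE mulr_sumr; apply: eq_bigr => j _.
by rewrite mxE mul_mpolyC scalerA.
Qed.

Lemma meval_linear_vf A (v : 'cV[K]_n) i :
  (linear_vf A i 0).@[fun j => v j 0] = (A *m v) i 0.
Proof.
rewrite !mxE raddf_sum; apply: eq_bigr => j _.
by rewrite /= mevalZ mevalXU.
Qed.

Lemma meval_vf_apply delta f (v : 'I_n -> K) :
  (vf_apply delta f).@[v] = \sum_i (delta i 0).@[v] * f^`M(i).@[v].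
Proof.
by rewrite /vf_apply raddf_sum; apply: eq_bigr => i _; rewrite /= mevalM.
Qed.

(** Pullback along the linear map [P]. With [invmx P] in place of [P] it rewrites [f] in the
    coordinates [P *m v]. *)
Definition lin_subst m (P : 'M[K]_(n, m)) (f : {mpoly K[n]}) : {mpoly K[m]} :=
  mmap (@mpolyC m K) (fun i => \sum_j P i j *: 'X_j) f.

Lemma meval_lin_subst m (P : 'M[K]_(n, m)) f (v : 'cV[K]_m) :
  (lin_subst P f).@[fun i => v i 0] = f.@[fun i => (P *m v) i 0].
Proof.
elim/mpoly_ring_ind: f => [c|i|p q IHp IHq|p q IHp IHq].
- by rewrite /lin_subst mmapC !mevalC.
- rewrite /lin_subst mmapX mmap1U mevalXU raddf_sum mxE; apply: eq_bigr => j _.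
  by rewrite /= mevalZ mevalXU.
- by rewrite /lin_subst mmapD !mevalD IHp IHq.
- by rewrite /lin_subst rmorphM !mevalM IHp IHq.
Qed.

End VectorFields.

Lemma mpoly_eq_meval (K : numDomainType) n (p q : {mpoly K[n]}) :
  (forall v : 'cV_n, p.@[fun i => v i 0] = q.@[fun i => v i 0]) -> p = q.
Proof.
move=> pq; apply/eqP; rewrite -subr_eq0; apply/eqP/mpoly_eq0_meval => v.
rewrite mevalB; have := pq (\col_i v i); under meval_eq => i do rewrite mxE.
by under [X in _ = X]meval_eq => i do rewrite mxE; move=> ->; rewrite subrr.
Qed.

(** * Additive Jordan decomposition *)

Lemma polynomial_crt (K : fieldType) (m : nat) (rs : seq K) : uniq rs ->
  exists s : {poly K}, forall z, z \in rs -> ('X - z%:P) ^+ m %| s - z%:P.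
Proof.
elim: rs => [|a rs IHrs] /=; first by exists 0.
case/andP=> aNrs /IHrs[s sP]; pose M := \prod_(z <- rs) ('X - z%:P).
have /Bezout_eq1_coprimepP[[u v] /= uvE] : coprimep (('X - a%:P) ^+ m) (M ^+ m).
  apply/coprimep_expr; rewrite coprimep_sym; apply/coprimep_expr.
  by rewrite coprimep_XsubC root_prod_XsubC.
(* By Bezout, the factor of [s] is 1 modulo [M ^+ m] and 0 modulo the power of X - a, and the factor
   of [a] behaves the other way round. *)
exists (s * (u * ('X - a%:P) ^+ m) + a%:P * (v * M ^+ m)) => z.
rewrite inE => /predU1P[->|zrs].
  have -> : s * (u * ('X - a%:P) ^+ m) + a%:P * (v * M ^+ m) - a%:P
            = (s - a%:P) * u * ('X - a%:P) ^+ m.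
    rewrite -[X in _ - X]mulr1 -uvE; move: (v * _) (_ ^+ m) => x y.
    by rewrite mulrDr opprD addrACA subrr addr0 !mulrBl !mulrA.
  exact: dvdp_mulIr.
have -> : s * (u * ('X - a%:P) ^+ m) + a%:P * (v * M ^+ m) - z%:P
          = (s - z%:P) * (u * ('X - a%:P) ^+ m) + (a%:P - z%:P) * v * M ^+ m.
  rewrite -[X in _ - X]mulr1 -uvE; move: (u * _) (M ^+ m) => x y.
  by rewrite mulrDr opprD addrACA !mulrBl !mulrA.
apply: dvdp_add; first by rewrite dvdp_mulr // sP.
by rewrite dvdp_mull // dvdp_exp2r // dvdp_XsubCl root_prod_XsubC.
Qed.

(** Take [s] congruent to z modulo a high power of X - z for each eigenvalue z. Then q divides X -
    s, which makes A - s(A) nilpotent, while the product of the s - z is a multiple of the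
    characteristic polynomial, so that s(A) is killed by a polynomial with simple roots. *)
Lemma jordan_chevalley (K : closedFieldType) (n : nat) (A : 'M[K]_n.+1) :
  exists2 s : {poly K}, diagonalizable (horner_mx A s) &
    exists k, (A - horner_mx A s) ^+ k = 0.
Proof.
have [rs charE] := closed_field_poly_normal (char_poly A).
rewrite (monicP (char_poly_monic A)) scale1r in charE.
(* [m] bounds the multiplicity of every root; the exponent [m.+1] used below is visibly positive, so
   that the congruences give s(z) = z. *)
set us := undup rs; set m := (size rs).
have [s sP] := polynomial_crt m.+1 (undup_uniq rs).
pose q := \prod_(z <- us) ('X - z%:P).
have char_dvd : char_poly A %| q ^+ m.+1.
  rewrite exprS dvdp_mull // charE /m.
  have: {subset rs <= us} by move=> z; rewrite mem_undup.
  elim: (rs) => [|z l IHl] lus; first by rewrite big_nil expr0.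
  rewrite big_cons /= exprS dvdp_mul ?IHl //.
    by rewrite dvdp_XsubCl root_prod_XsubC lus ?mem_head.
  by move=> x xl; rewrite lus // inE xl orbT.
have horner0 p : q ^+ m.+1 %| p -> horner_mx A p = 0.
  move=> /(dvdp_trans char_dvd)/dvdpP[r ->].
  by rewrite rmorphM /= Cayley_Hamilton mulr0.
exists s; last first.
  exists m.+1; rewrite -{1}[A]horner_mx_X -raddfB -rmorphXn /=.
  apply/horner0/dvdp_exp2r/uniq_roots_dvdp; last first.
    by rewrite uniq_rootsE undup_uniq.
  apply/allP => z zus; rewrite /root !hornerE subr_eq0 eq_sym -subr_eq0.
  have := sP z zus; rewrite exprS => /(dvdp_trans (dvdp_mulIl _ _)).
  by rewrite dvdp_XsubCl /root !hornerE.
apply/diagonalizableP; exists us; first exact: undup_uniq.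
apply: mxminpoly_min; rewrite rmorph_prod /=.
transitivity (horner_mx A (\prod_(z <- us) (s - z%:P))).
  rewrite rmorph_prod /=; apply: eq_bigr => z _.
  by rewrite !rmorphB /= horner_mx_X !horner_mx_C.
apply: horner0; rewrite /q -prodrXl big_seq [X in _ %| X]big_seq.
by apply: (big_ind2 (fun a b => a %| b)) => // a b c d; exact: dvdp_mul.
Qed.

(** * Linear derivations of the polynomial ring *)

Section LocallyNilpotent.
Variables (S : comNzRingType) (D : S -> S).
Hypothesis DD : {morph D : x y / x + y}.
Hypothesis DM : forall x y, D (x * y) = D x * y + x * D y.

Definition locally_nilpotent_at p := exists k, iter k D p = 0.

Let D0 : D 0 = 0.
Proof. by apply: (addrI (D 0)); rewrite -DD !addr0. Qed.

Let iter_add k : {morph iter k D : x y / x + y}.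
Proof. by move=> x y; elim: k => [//|k IHk]; rewrite !iterS IHk DD. Qed.

Let iter0 k : iter k D 0 = 0.
Proof. by elim: k => //= k ->. Qed.

Lemma locally_nilpotentD p q : locally_nilpotent_at p ->
  locally_nilpotent_at q -> locally_nilpotent_at (p + q).
Proof.
move=> [k pk] [l ql]; exists (k + l)%N.
by rewrite iter_add {1}addnC !iterD pk ql !iter0 addr0.
Qed.

(** Leibniz writes D (p q) as a sum of two products, each with one exponent lowered; hence the
    induction on [k + l]. *)
Lemma locally_nilpotentM p q : locally_nilpotent_at p ->
  locally_nilpotent_at q -> locally_nilpotent_at (p * q).
Proof.
move=> [k pk] [l ql]; exists (k + l)%N.
elim: {k l}(k + l)%N {-2}k {-2}l (erefl (k + l)%N) p q pk ql => [|s IHs] k l.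
  move=> /eqP; rewrite addn_eq0 => /andP[/eqP-> /eqP->] p q /= -> ->.
  by rewrite mulr0.
case: k => [|k] skl p q pk ql; first by rewrite /= in pk; rewrite pk mul0r iter0.
case: l skl ql => [|l] skl ql; first by rewrite /= in ql; rewrite ql mulr0 iter0.
have e1 : (k + l.+1)%N = s by apply: succn_inj; rewrite -skl addSn.
have e2 : (k.+1 + l)%N = s by apply: succn_inj; rewrite -skl addnS.
rewrite skl iterSr DM iter_add.
have -> : iter s D (D p * q) = 0 by rewrite -e1 IHs // -iterSr.
by rewrite add0r -e2 IHs // -iterSr.
Qed.

End LocallyNilpotent.

Section LinearDerivations.
Variables (K : numClosedFieldType) (n : nat).
Implicit Types (f g p q : {mpoly K[n]}) (A B N : 'M[K]_n) (lam : K).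

Definition lin_der A f := vf_apply (linear_vf A) f.

Lemma lin_derD A : {morph lin_der A : p q / p + q}.
Proof. exact: vf_applyD. Qed.

Lemma lin_derZ A c p : lin_der A (c *: p) = c *: lin_der A p.
Proof. exact: vf_applyZ. Qed.

Lemma lin_derDl A B p : lin_der (A + B) p = lin_der A p + lin_der B p.
Proof. by rewrite /lin_der linear_vfD vf_applyDl. Qed.

Lemma lin_derZl c A p : lin_der (c *: A) p = c *: lin_der A p.
Proof. by rewrite /lin_der linear_vfZ vf_applyZl mul_mpolyC. Qed.

Lemma lin_derB A : {morph lin_der A : p q / p - q}.
Proof. by move=> p q; rewrite lin_derD -scaleN1r lin_derZ scaleN1r. Qed.

Lemma lin_der0 A : lin_der A 0 = 0.
Proof. exact: vf_apply0. Qed.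

Lemma lin_derM A p q : lin_der A (p * q) = lin_der A p * q + p * lin_der A q.
Proof. exact: vf_applyM. Qed.

Lemma lin_derC A c : lin_der A c%:MP = 0.
Proof. exact: vf_applyC. Qed.

Lemma lin_derXU A i : lin_der A 'X_i = \sum_j A i j *: 'X_j.
Proof. by rewrite /lin_der vf_applyXU mxE. Qed.

Lemma lin_der_lin_form A B i :
  lin_der B (\sum_j A i j *: 'X_j) = \sum_j (A *m B) i j *: 'X_j.
Proof.
rewrite (big_morph _ (lin_derD B) (lin_der0 B)).
under eq_bigr => j _ do rewrite lin_derZ lin_derXU scaler_sumr.
rewrite exchange_big /=; apply: eq_bigr => k _; rewrite mxE scaler_suml.
by apply: eq_bigr => j _; rewrite scalerA.
Qed.

(** The commutator of two derivations is a derivation, so it is enough to look at the variables. *)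
Lemma lin_der_comm A B p : A *m B = B *m A ->
  lin_der A (lin_der B p) = lin_der B (lin_der A p).
Proof.
move=> AB; elim/mpoly_ring_ind: p => [c|i|p q IHp IHq|p q IHp IHq].
- by rewrite !lin_derC ?lin_der0.
- by rewrite !lin_derXU !lin_der_lin_form AB.
- by rewrite !lin_derD IHp IHq.
- by rewrite !(lin_derM, lin_derD) IHp IHq addrACA.
Qed.

(** On linear forms the derivation is multiplication by [N], hence nilpotent; the locally nilpotent
    elements form a subalgebra. *)
Lemma lin_der_nilpotent N k : N ^+ k = 0 ->
  forall p, locally_nilpotent_at (lin_der N) p.
Proof.
move=> Nk; elim/mpoly_ring_ind => [c|i|p q IHp IHq|p q IHp IHq].
- by exists 1; rewrite /= lin_derC.
- exists k; suff -> : iter k (lin_der N) 'X_i = \sum_j (N ^+ k) i j *: 'X_j.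
    by rewrite Nk big1 // => j _; rewrite mxE scale0r.
  elim: k {Nk} => [|k IHk] /=; last by rewrite IHk lin_der_lin_form exprSr.
  rewrite (bigD1 i) //= big1 ?addr0 => [|j jNi]; rewrite mxE.
    by rewrite eqxx scale1r.
  by rewrite eq_sym (negPf jNi) scale0r.
- exact: (locally_nilpotentD (@lin_derD N) IHp IHq).
- exact: (locally_nilpotentM (@lin_derD N) (@lin_derM N) IHp IHq).
Qed.

Lemma lin_der_diag (d : 'rV[K]_n) f (m : 'X_{1..n}) :
  (lin_der (diag_mx d) f)@_m = (\sum_i d 0 i * (m i)%:R) * f@_m.
Proof.
elim/mpolyind: f => [|c m' p _ _ IHp].
  by rewrite lin_der0 !mcoeff0 mulr0.
rewrite lin_derD lin_derZ !mcoeffD !mcoeffZ IHp mulrDr; congr (_ + _).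
suff -> : lin_der (diag_mx d) 'X_[m'] = (\sum_i d 0 i * (m' i)%:R) *: 'X_[m'].
  rewrite mcoeffZ mcoeffX; have [->|_] := eqVneq m' m; last by rewrite !mulr0.
  by rewrite !mulr1 mulrC.
rewrite scaler_suml; apply: eq_bigr => i _.
rewrite mxE (bigD1 i) //= big1 ?addr0 => [|j jNi]; last first.
  by rewrite mxE eq_sym (negPf jNi) scale0r.
rewrite mxE eqxx mulr1n mderivX -scalerAl -scalerAr scalerA.
(* The subtraction of exponents is truncated when [m' i] is 0, but then the coefficient vanishes. *)
case: (eqVneq (m' i) 0%N) => [->|mi]; first by rewrite mulr0 !scale0r.
by rewrite -mpolyXD addmC submK ?lep1mP.
Qed.

(* On f the operator lam - lin_der (diag_mx d), which is diagonal in the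
   monomial basis, coincides with the locally nilpotent lin_der N. *)
Lemma diag_nilpotent_eigen (d : 'rV[K]_n) N k f lam :
  diag_mx d *m N = N *m diag_mx d -> N ^+ k = 0 ->
  lin_der (diag_mx d + N) f = lam *: f ->
  (forall m, m \in msupp f -> \sum_i d 0 i * (m i)%:R = lam) /\
  lin_der N f = 0.
Proof.
move=> dN Nk fE; have [l fl] := lin_der_nilpotent Nk f.
pose E p := lam *: p - lin_der (diag_mx d) p.
have EfE : E f = lin_der N f by rewrite /E -fE lin_derDl addrC addKr.
(* [E] commutes with [lin_der N] and agrees with it on [f], so all their iterates agree on [f]. *)
have iterE j : iter j E f = iter j (lin_der N) f.
  elim: j => //= j ->; rewrite -iterS iterSr -EfE; elim: j => //= j <-.
  by rewrite /E lin_derB lin_derZ lin_der_comm.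
have coefE j m : (iter j E f)@_m = (lam - \sum_i d 0 i * (m i)%:R) ^+ j * f@_m.
  elim: j => [|j IHj]; first by rewrite expr0 mul1r.
  by rewrite iterS /E mcoeffB mcoeffZ lin_der_diag -mulrBl IHj mulrA exprS.
have supp m : m \in msupp f -> \sum_i d 0 i * (m i)%:R = lam.
  move=> mf; apply/eqP; rewrite eq_sym -subr_eq0.
  have /eqP := coefE l m; rewrite iterE fl mcoeff0 eq_sym mulf_eq0.
  by rewrite mcoeff_msupp in mf; rewrite (negPf mf) orbF expf_eq0 => /andP[].
split=> //; rewrite -EfE; apply/mpolyP => m.
rewrite -[E f]/(iter 1 E f) coefE mcoeff0 expr1.
have [mf|mf] := boolP (m \in msupp f); first by rewrite supp // subrr mul0r.
by rewrite memN_msupp_eq0 // mulr0.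
Qed.

Lemma lin_der_nilpotent_eigen N k f lam : N ^+ k = 0 ->
  lin_der N f = lam *: f -> lin_der N f = 0.
Proof.
move=> Nk fE; have := @diag_nilpotent_eigen 0 N k f lam.
by rewrite raddf0 add0r mulmx0 mul0mx => -[].
Qed.

(** The hypothesis says that the linear map [Q] carries the vector field of [B] to that of [A];
    pullback along [Q] then intertwines the two derivations. *)
Lemma lin_der_lin_subst (Q A B : 'M[K]_n) f : Q *m B = A *m Q ->
  lin_der B (lin_subst Q f) = lin_subst Q (lin_der A f).
Proof.
move=> QB; rewrite /lin_subst (derivation_mmap _ (@lin_derD B) (@lin_derM B)).
  rewrite raddf_sum; apply: eq_bigr => i _; rewrite lin_der_lin_form QB /=.
  rewrite rmorphM mulrC mxE; congr (_ * _).
  rewrite raddf_sum; under [RHS]eq_bigr => j _.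
    rewrite /= mmapZ mmapX mmap1U mul_mpolyC scaler_sumr. over.
  rewrite exchange_big; apply: eq_bigr => j _; rewrite mxE scaler_suml.
  by apply: eq_bigr => k _; rewrite scalerA.
by move=> c; exact: lin_derC.
Qed.

(** The exponential of t N when [N ^+ k = 0]: the truncated series is exact and polynomial in t, so
    no limit is involved. *)
Definition nilpotent_exp (N : 'M[K]_n) k (t : K) : 'M[K]_n :=
  \sum_(l < k) (t ^+ l / l`!%:R) *: N ^+ l.

(** Along the curve t -> exp(t N) v, whose coordinates are the polynomials [q i] with q' = N q, the
    derivative of [f] is the value of [lin_der N f], that is 0. So [f] keeps its value at t = 0. *)
Lemma meval_nilpotent_exp N k f (t : K) (v : 'cV[K]_n) : N ^+ k = 0 ->
  lin_der N f = 0 ->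
  f.@[fun i => (nilpotent_exp N k t *m v) i 0] = f.@[fun i => v i 0].
Proof.
move=> Nk Nf.
have Nge l : (k <= l)%N -> N ^+ l = 0 by move=> /subnK<-; rewrite exprD Nk mulr0.
pose q i := \poly_(l < k) ((N ^+ l *m v) i 0 / l`!%:R).
have coefq i l : (q i)`_l = (N ^+ l *m v) i 0 / l`!%:R.
  rewrite coef_poly; case: ltnP => // /Nge ->.
  by rewrite mul0mx mxE mul0r.
have dq i : (q i)^`() = \sum_j N i j *: q j.
  apply/polyP => l; rewrite coef_deriv coefq coef_sum.
  under eq_bigr => j _ do rewrite coefZ coefq mulrA.
  rewrite -mulr_suml exprS -[N * _]/(N *m _) -mulmxA mxE.
  rewrite -[_ / _ *+ _]mulr_natr -mulrA.
  congr (_ * _); rewrite factS natrM invfM mulrAC mulVf ?mul1r //.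
  by rewrite pnatr_eq0.
pose r := mmap polyC q f.
have dr : r^`() = 0.
  rewrite /r (@derivation_mmap _ _ _ polyC q (@deriv K)); last 3 first.
  - exact: derivD.
  - exact: derivM.
  - exact: derivC.
  transitivity (mmap polyC q (lin_der N f)); last by rewrite Nf mmap0.
  rewrite raddf_sum; apply: eq_bigr => i _ /=; rewrite dq rmorphM mulrC mxE.
  congr (_ * _); rewrite raddf_sum; apply: eq_bigr => j _ /=.
  by rewrite mmapZ mmapX mmap1U mul_polyC.
have rC : r = (r`_0)%:P.
  apply/polyP => -[|l]; rewrite coefC //=.
  have := congr1 (fun p : {poly K} => p`_l) dr; rewrite coef_deriv coef0.
  by move/eqP; rewrite mulrn_eq0 /= => /eqP.
have ev s : r.[s] = f.@[fun i => (nilpotent_exp N k s *m v) i 0].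
  rewrite horner_mmap; apply: meval_eq => i; rewrite horner_poly.
  rewrite mulmx_suml summxE; apply: eq_bigr => l _.
  by rewrite -scalemxAl [RHS]mxE [RHS]mulrC -[LHS]mulrA [l`!%:R^-1 * _]mulrC.
rewrite -ev rC hornerC -horner_coef0 horner_mmap; apply: meval_eq => i.
by rewrite horner_coef0 coefq expr0 mul1mx divr1.
Qed.

(** The exponential has the form 1 - N y with N y nilpotent, and is inverted by a geometric
    series. *)
Lemma nilpotent_exp_unit N k t : N ^+ k = 0 ->
  nilpotent_exp N k t \in unitmx.
Proof.
(* For k = 0 the hypothesis reads 1 = 0, and the empty sum is invertible. *)
case: k => [N0|k Nk].
  have I0 : (1%:M : 'M[K]_n) = 0 by [].
  by rewrite /nilpotent_exp big_ord0 -I0 unitmx1.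
pose y := - \sum_(l < k) (t ^+ l.+1 / l.+1`!%:R) *: N ^+ l.
have yE : 1 - N * y = nilpotent_exp N k.+1 t.
  rewrite /nilpotent_exp big_ord_recl expr0 expr0 divr1 scale1r mulrN opprK.
  congr (_ + _); rewrite mulr_sumr; apply: eq_bigr => l _.
  by rewrite -[N * _]/(N *m _) -scalemxAr -[N *m _]/(N * _) -exprS lift0.
have Ny : GRing.comm N y.
  apply: commrN; apply: commr_sum => l _.
  rewrite /GRing.comm -[LHS]scalemxAr -[RHS]scalemxAl.
  by rewrite -[N *m _]exprS -[_ *m N]exprSr.
have := subrX1 (N * y) k.+1; rewrite (exprMn_comm _ Ny) Nk mul0r sub0r.
move=> /eqP; rewrite -[N * y - 1]opprB yE mulNr eqr_opp => /eqP/esym.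
by move=> /mulmx1_unit[].
Qed.

End LinearDerivations.

(** * Connected subgroups preserving a set *)

Section MatrixTopology.
Variables (T : topologicalType) (K : numFieldType).

Lemma continuous_big_sum (I : Type) (r : seq I) (F : I -> T -> K) :
  (forall i, continuous (F i)) -> continuous (fun t => \sum_(i <- r) F i t).
Proof.
move=> Fc; elim: r => [|i r IHr] t.
  by under eq_fun do rewrite big_nil; exact: cst_continuous.
under eq_fun do rewrite big_cons.
by apply: (@continuousD _ _ _ (F i)); [exact: Fc|exact: IHr].
Qed.

Lemma continuous_mx m n (F : T -> 'M[K]_(m, n)) :
  (forall i j, continuous (fun t => F t i j)) -> continuous F.
Proof.
move=> Fc t A [P MP sPA].
have : \forall s \near t, forall ij : 'I_m * 'I_n, P ij.1 ij.2 (F s ij.1 ij.2).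
  by apply: filter_forall => -[i j] /=; exact: Fc (MP i j).
by apply: filterS => s Ps; apply: sPA => i j; exact: Ps (i, j).
Qed.

Lemma continuous_coord m n (F : T -> 'M[K]_(m, n)) i j :
  continuous F -> continuous (fun t => F t i j).
Proof.
move=> Fc t; apply: (@continuous_comp _ _ _ F (fun M : 'M[K]_(m, n) => M i j)).
  exact: Fc.
exact: coord_continuous.
Qed.

Lemma continuous_mulmx m n p (F : T -> 'M[K]_(m, n)) (G : T -> 'M[K]_(n, p)) :
  continuous F -> continuous G -> continuous (fun t => F t *m G t).
Proof.
move=> Fc Gc; apply: continuous_mx => i j.
under eq_fun do rewrite mxE; apply: continuous_big_sum => k t.
by apply: continuousM; exact: continuous_coord.
Qed.

Lemma continuous_expr (g : T -> K) q :
  continuous g -> continuous (fun t => g t ^+ q).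
Proof.
move=> gc; elim: q => [|q IHq]; first exact: cst_continuous.
have -> : (fun t => g t ^+ q.+1) = (fun t => g t * g t ^+ q).
  by apply/funext => t; rewrite exprS.
by move=> t; apply: (@continuousM _ _ g (fun t => g t ^+ q)); [exact: gc|exact: IHq].
Qed.

Lemma closed_zero_set (g : T -> K) : continuous g -> closed [set t | g t = 0].
Proof.
move=> gc; rewrite -[X in closed X]/(g @^-1` [set 0]).
move/continuous_closedP: gc; apply.
by apply: accessible_closed_set1; exact/hausdorff_accessible/norm_hausdorff.
Qed.

End MatrixTopology.

Section StabilizerComponent.
Variables (K : numClosedFieldType) (n : nat) (D : set 'cV[K]_n).

Definition set_stabilizer : set 'M[K]_n :=
  [set A | A \in unitmx /\ forall v, D (A *m v) <-> D v].

Lemma preserves_stabilizer (H : set 'M[K]_n) :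
  GL_subgroup H -> preserves H D -> H `<=` set_stabilizer.
Proof.
move=> [Hu _ _ _] HD A HA; have Au := Hu A HA; split=> // v; split=> [DAv|Dv].
  have := DAv; rewrite -{1}(HD A HA) => -[w Dw] /(congr1 (mulmx (invmx A))).
  by rewrite !mulKmx // => <-.
by rewrite -(HD A HA); exists v.
Qed.

Lemma stabilizer_preserves (H : set 'M[K]_n) :
  H `<=` set_stabilizer -> preserves H D.
Proof.
move=> HS A /HS[Au AD]; apply/seteqP; split=> [_ [v Dv <-]|v Dv]; first exact/AD.
by exists (invmx A *m v); rewrite ?mulKVmx //; apply/AD; rewrite mulKVmx.
Qed.

(* The identity component of the stabilizer is a connected subgroup. *)
Lemma connected_stabilizer_sub (G X : set 'M[K]_n) : associated_group D G ->
  connected X -> X 1%:M -> X `<=` set_stabilizer -> X `<=` G.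
Proof.
move=> [_ Gmax] Xc X1 XS.
pose C := connected_component set_stabilizer (1%:M : 'M[K]_n).
have S1 : set_stabilizer 1%:M by exact: XS.
have SV A : set_stabilizer A -> set_stabilizer (invmx A).
  move=> [Au AD]; split=> [|v]; first by rewrite unitmx_inv.
  by rewrite -{2}[v](mulKVmx Au); symmetry; exact: AD.
have SM A B : set_stabilizer A -> set_stabilizer B -> set_stabilizer (A *m B).
  move=> [Au AD] [Bu BD]; split=> [|v]; first by rewrite unitmx_mul Au.
  by rewrite -mulmxA; split=> [/AD/BD|/BD/AD].
(* The translate of the component [C] by [A] is connected and stays in the stabilizer, so it lies in
   [C] as soon as it contains 1 (used for inverses) or [A], its image of 1, is in [C] (used for
   products). *)
have translate A B : set_stabilizer A -> C B -> (mulmx A @` C) 1%:M \/ C A ->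
    C (A *m B).
  move=> SA CB CA.
  have Ac : connected (mulmx A @` C).
    apply: connected_continuous_connected; first exact: component_connected.
    apply: continuous_subspaceT; apply: continuous_mulmx.
      exact: cst_continuous.
    by move=> M; apply: cvg_id.
  have AS : mulmx A @` C `<=` set_stabilizer.
    by move=> _ [M /connected_component_sub MS <-]; exact: SM.
  case: CA => CA.
    by apply: (connected_component_max CA AS Ac); exists B.
  apply: (connected_component_trans CA).
  apply: (connected_component_max _ AS Ac); last by exists B.
  by exists 1%:M; rewrite ?mulmx1 //; exact: connected_component_refl.
have CS : C `<=` set_stabilizer by exact: connected_component_sub.
suff CG : C `<=` G.
  by apply: subset_trans CG; exact: connected_component_max.
apply: Gmax; split; last exact: stabilizer_preserves.
- split.
  + by move=> A /CS[].
  + exact: connected_component_refl.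
  + by move=> A B CA CB; apply: translate; [exact: CS| |right].
  + move=> A CA; rewrite -[invmx A]mulmx1; apply: translate.
    * exact/SV/CS.
    * exact: connected_component_refl.
    * by left; exists A => //; have [Au _] := CS _ CA; rewrite mulVmx.
- exact: component_connected.
Qed.

End StabilizerComponent.

Section ComplexCurves.
Variable R : realType.
Notation C := (R[i]%C : numClosedFieldType).

Lemma continuous_real_complex : continuous (fun x : R => x%:C%C : C).
Proof.
move=> x; apply/cvgrPdist_lt => e e0.
(* A positive element of R[i] is real, so the radius can be taken in R. *)
have [eI eR] : complex.Im e = 0 /\ 0 < complex.Re e.
  by move: e0; rewrite ltcE /= => /andP[/eqP-> ->].
have -> : e = (complex.Re e)%:C%C by apply/eqP; rewrite eq_complex /= eI !eqxx.
near=> y.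
rewrite -rmorphB /= normc_def /= expr0n addr0 sqrtr_sqr ltcE /= eqxx /=.
by near: y; exists (complex.Re e).
Unshelve. all: by end_near. Qed.

Lemma connected_curve (T : topologicalType) (F : R -> T) :
  continuous F -> connected (range F).
Proof.
move=> Fc; apply: connected_continuous_connected.
  by apply/connected_intervalP.
exact: continuous_subspaceT.
Qed.

End ComplexCurves.

Section Conjugation.
Variables (K : fieldType) (n : nat) (P : 'M[K]_n).
Hypothesis Pu : P \in unitmx.

Lemma conjmx_stableM (A B : 'M[K]_n) :
  P *m (A *m B) *m invmx P = (P *m A *m invmx P) *m (P *m B *m invmx P).
Proof. by rewrite !mulmxA mulmxKV. Qed.

Lemma comm_conjmx (A B : 'M[K]_n) :
  (P *m A *m invmx P) *m (P *m B *m invmx P) =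
    (P *m B *m invmx P) *m (P *m A *m invmx P) <-> A *m B = B *m A.
Proof.
rewrite -!conjmx_stableM; split=> [|->//].
by move=> /(can_inj (mulmxKV Pu))/(can_inj (mulKmx Pu)).
Qed.

End Conjugation.

Lemma jordan_coordinates (K : closedFieldType) (n : nat) (A : 'M[K]_n.+1) :
  exists2 P, P \in unitmx & exists (d : 'rV_n.+1) (N : 'M[K]_n.+1) (k : nat),
    [/\ P *m A *m invmx P = diag_mx d + N, diag_mx d *m N = N *m diag_mx d &
        N ^+ k = 0].
Proof.
have [s [P Pu /diagonalizable_forPex[d]]] := jordan_chevalley A.
move/(simmxRL Pu); set S := horner_mx A s => dE [k Nk].
exists P => //; exists d, (P *m (A - S) *m invmx P), k; split.
- by rewrite dE mulmxBr mulmxBl addrC subrK.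
- rewrite dE; apply/comm_conjmx => //; rewrite mulmxBr mulmxBl.
  by congr (_ - _); apply: comm_horner_mx.
suff -> : (P *m (A - S) *m invmx P) ^+ k = P *m ((A - S) ^+ k) *m invmx P.
  by rewrite Nk mulmx0 mul0mx.
elim: (k) => [|l IHl]; first by rewrite !expr0 mulmx1 mulmxV.
by rewrite exprS IHl exprS; exact: esym (conjmx_stableM Pu _ _).
Qed.

(** * One-parameter subgroups of the associated group *)

Section OneParameterGroups.
Variables (K : numClosedFieldType) (n' : nat).
Notation n := n'.+1.

(** The entries of the commutator of [B] with exp(t N) are polynomials in t with infinitely many
    zeros; their coefficients of t form the commutator of [B] with [N]. *)
Lemma comm_nilpotent_exp (N B : 'M[K]_n) k : N ^+ k = 0 ->
  (forall t : nat,
     B *m nilpotent_exp N k t%:R = nilpotent_exp N k t%:R *m B) ->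
  B *m N = N *m B.
Proof.
move=> Nk BN; apply/matrixP => i j.
pose p : {poly K} :=
  \poly_(l < k) ((B *m N ^+ l - N ^+ l *m B) i j / l`!%:R).
have : p = 0.
  apply: poly_eq0_on_nat => t; rewrite horner_poly.
  have /matrixP/(_ i j) := BN t.
  rewrite /nilpotent_exp mulmx_sumr mulmx_suml !summxE.
  move=> /(congr1 (fun x => x - \sum_(l < k)
    ((t%:R ^+ l / l`!%:R) *: N ^+ l *m B) i j)); rewrite subrr -sumrB => E.
  rewrite -[RHS]E; apply: eq_bigr => l _; rewrite -scalemxAr -scalemxAl !mxE.
  by rewrite -mulrBr [RHS]mulrC -[LHS]mulrA [l`!%:R^-1 * _]mulrC.
move=> /(congr1 (fun q : {poly K} => q`_1)); rewrite coef_poly coef0.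
(* The linear term is present only if 1 < k; otherwise [N] itself is zero. *)
case: ltnP => [_|k1 _].
  by rewrite divr1 expr1 !mxE => /eqP; rewrite subr_eq0 => /eqP.
have -> : N = 0 by rewrite -[N]expr1 -(subnK k1) exprD Nk mulr0.
by rewrite mulmx0 mul0mx.
Qed.

Variables (R : realType) (iota : {rmorphism R -> K}).
Hypothesis iota_cont : continuous (iota : R -> K).

Variables (f : {mpoly K[n]}) (G : set 'M[K]_n).
Hypothesis Gf : associated_group (zero_locus f) G.

(** A curve that multiplies [f] by nonzero scalars stabilizes its zero locus; being connected and
    passing through 1, it stays in [G]. The curve [F] is given in the coordinates [P *m v]. *)
Lemma semi_invariant_curve_sub (P : 'M[K]_n) (F : R -> 'M[K]_n) :
  P \in unitmx -> continuous F -> F 0 = 1%:M ->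
  (forall t, F t \in unitmx) ->
  (forall t, exists2 c : K, c != 0 & forall v : 'cV[K]_n,
     (lin_subst (invmx P) f).@[fun i => (F t *m v) i 0] =
       c * (lin_subst (invmx P) f).@[fun i => v i 0]) ->
  forall t, G (invmx P *m F t *m P).
Proof.
move=> Pu Fc F0 Fu Ff t; pose F' s := invmx P *m F s *m P.
apply: (connected_stabilizer_sub Gf (X := range F')); last by exists t.
- apply: connected_curve; apply: continuous_mulmx; last exact: cst_continuous.
  by apply: continuous_mulmx; [exact: cst_continuous|exact: Fc].
- by exists 0; rewrite // /F' F0 mulmx1 mulVmx.
move=> _ [s _ <-]; split=> [|v].
  by rewrite !unitmx_mul unitmx_inv Pu Fu.
have [c c0 cE] := Ff s.
have -> : zero_locus f (F' s *m v) =
    (f.@[fun i => (invmx P *m (F s *m (P *m v))) i 0] = 0).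
  by rewrite /F' -!mulmxA.
rewrite -meval_lin_subst cE meval_lin_subst mulKmx //; split=> [/eqP|].
  by rewrite mulf_eq0 (negPf c0) => /eqP.
by rewrite /zero_locus /= => ->; rewrite mulr0.
Qed.

Definition diag_curve (a : 'I_n -> R) (t : R) : 'M[K]_n :=
  diag_mx (\row_i iota (expR (t * a i))).

Lemma iota_expR_neq0 (x : R) : iota (expR x) != 0.
Proof. by rewrite fmorph_eq0 gt_eqF // expR_gt0. Qed.

Lemma diag_curve_continuous a : continuous (diag_curve a).
Proof.
apply: continuous_mx => i j.
have -> : (fun t => diag_curve a t i j) =
    (fun t => iota (expR (t * a i)) *+ (i == j)).
  by apply/funext => t; rewrite !mxE.
case: eqP => _; last exact: cst_continuous.
suff ec : continuous (fun t : R => iota (expR (t * a i))) by exact: ec.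
move=> t; apply: (@continuous_comp R R K (fun t : R => expR (t * a i)) iota).
  apply: (@continuous_comp R R R (fun t : R => t * a i) expR).
    apply: (@continuousM _ _ idfun (cst (a i))); first exact: cvg_id.
    exact: cst_continuous.
  exact: continuous_expR.
exact: iota_cont.
Qed.

Lemma diag_curve0 a : diag_curve a 0 = 1%:M.
Proof.
apply/matrixP => i j; rewrite !mxE; case: eqP => // _.
by rewrite mul0r expR0 rmorph1.
Qed.

Lemma diag_curve_unit a t : diag_curve a t \in unitmx.
Proof.
rewrite unitmxE det_diag unitfE; apply/prodf_neq0 => i _.
by rewrite mxE iota_expR_neq0.
Qed.

Lemma meval_diag_curve (f1 : {mpoly K[n]}) a b t (v : 'cV[K]_n) :
  (forall m, m \in msupp f1 -> \sum_i a i * (m i)%:R = b) ->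
  f1.@[fun i => (diag_curve a t *m v) i 0] =
    iota (expR (t * b)) * f1.@[fun i => v i 0].
Proof.
move=> ab; rewrite !mevalE mulr_sumr !big_seq; apply: eq_bigr => m mf.
rewrite mulrCA; congr (_ * _).
under eq_bigr => i _ do rewrite mul_diag_mx !mxE exprMn.
rewrite big_split /=; congr (_ * _).
rewrite -(ab m mf) mulr_sumr expR_sum rmorph_prod; apply: eq_bigr => i _ /=.
by rewrite mulrA expRM_natr rmorphXn.
Qed.

(** Compare the (i, j) entries. The exponents are real so that the exponential is injective; complex
    eigenvalues are recovered later from their real and imaginary parts. *)
Lemma comm_diag_curve (a : 'I_n -> R) (B : 'M[K]_n) i j :
  B *m diag_curve a 1 = diag_curve a 1 *m B -> B i j != 0 -> a i = a j.
Proof.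
move=> /matrixP/(_ i j); rewrite mul_mx_diag mul_diag_mx !mxE !mul1r.
by move=> + Bij; rewrite mulrC => /(mulIf Bij)/fmorph_inj/expR_inj.
Qed.

Variables (re im : {additive K -> R}).
Hypothesis reim_inj : forall x y, re x = re y -> im x = im y -> x = y.

(** What commutes with G commutes with its infinitesimal generators. In Jordan coordinates the
    diagonal and nilpotent parts of [A] give separate curves in [G], and commuting with those curves
    forces commuting with each part. *)
Lemma commutant_associated_group (A B : 'M[K]_n) lam :
  lin_der A f = lam *: f -> (forall g, G g -> B *m g = g *m B) ->
  B *m A = A *m B.
Proof.
move=> Af BG; have [P Pu [d [N [k [AE dN Nk]]]]] := jordan_coordinates A.
pose f1 := lin_subst (invmx P) f.
have f1E : lin_der (diag_mx d + N) f1 = lam *: f1.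
  rewrite (@lin_der_lin_subst _ _ _ A).
    by rewrite Af /f1 /lin_subst mmapZ mul_mpolyC.
  by rewrite -AE !mulmxA mulVmx // mul1mx.
have [supp Nf] := diag_nilpotent_eigen dN Nk f1E.
pose B1 := P *m B *m invmx P.
have B1comm M : G (invmx P *m M *m P) -> B1 *m M = M *m B1.
  move=> /BG BM; have := (comm_conjmx Pu B (invmx P *m M *m P)).2 BM.
  by rewrite [P *m (invmx P *m M *m P)]mulmxA mulmxK // mulKVmx.
(* Applying an additive [a] to the weight relations of the monomials of [f1] gives relations with
   real weights [a (d 0 i)], hence a curve in [G]. It is used with [re] and [im]. *)
have B1diag (a : {additive K -> R}) i j : B1 i j != 0 -> a (d 0 i) = a (d 0 j).
  apply: (comm_diag_curve (a := fun i => a (d 0 i))); apply: B1comm.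
  apply: (semi_invariant_curve_sub Pu (@diag_curve_continuous _)).
  - exact: diag_curve0.
  - exact: diag_curve_unit.
  move=> t; exists (iota (expR (t * a lam))); first exact: iota_expR_neq0.
  move=> v; apply: meval_diag_curve => m /supp <-; rewrite raddf_sum.
  by apply: eq_bigr => l _; rewrite !mulr_natr raddfMn.
apply/(comm_conjmx Pu); rewrite AE mulmxDr mulmxDl; congr (_ + _).
  apply/matrixP => i j; rewrite mul_mx_diag mul_diag_mx [LHS]mxE [RHS]mxE mulrC.
  have [->|Bij] := eqVneq (B1 i j) 0; first by rewrite !mulr0.
  by congr (_ * _); apply: reim_inj; apply/esym/B1diag.
apply: (comm_nilpotent_exp Nk) => t; apply: B1comm.
rewrite -[t%:R](rmorph_nat iota).
apply: (semi_invariant_curve_sub (F := fun t => nilpotent_exp N k (iota t)) Pu).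
- apply: continuous_mx => i j.
  have -> : (fun t => nilpotent_exp N k (iota t) i j) =
      (fun t => \sum_(l < k) iota t ^+ l * (l`!%:R^-1 * (N ^+ l) i j)).
    by apply/funext => u; rewrite summxE; apply: eq_bigr => l _; rewrite mxE mulrA.
  apply: continuous_big_sum => l u.
  apply: (@continuousM _ _ (fun t => iota t ^+ l) (cst _)).
    exact: continuous_expr iota_cont u.
  exact: cst_continuous.
- rewrite rmorph0 /nilpotent_exp; case: (k) Nk => [N0|l _].
    by move/eqP: N0; rewrite expr0 oner_eq0.
  rewrite big_ord_recl big1 ?addr0 => [|q _].
    by rewrite !expr0 divr1 scale1r.
  by rewrite lift0 exprS mul0r mul0r scale0r.
- by move=> u; apply: nilpotent_exp_unit.
move=> u; exists 1; first exact: oner_neq0.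
by move=> v; rewrite mul1r meval_nilpotent_exp.
Qed.

End OneParameterGroups.

(** * Abelian linear free divisors are normal crossings *)

Section LogarithmicLinearFields.
Variables (K : numClosedFieldType) (n : nat).
Implicit Types (f : {mpoly K[n]}) (A B : 'M[K]_n).

(* The matrices in g, in the notation of the opening comment. *)
Definition semi_invariant f A := exists lam : K, lin_der A f = lam *: f.

Lemma semi_invariant0 f : semi_invariant f 0.
Proof. by exists 0; rewrite -[0 in LHS](scale0r 0) lin_derZl !scale0r. Qed.

Lemma semi_invariantD f A B :
  semi_invariant f A -> semi_invariant f B -> semi_invariant f (A + B).
Proof.
by move=> [a aE] [b bE]; exists (a + b); rewrite lin_derDl aE bE scalerDl.
Qed.

Lemma semi_invariantZ f c A : semi_invariant f A -> semi_invariant f (c *: A).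
Proof. by move=> [a aE]; exists (c * a); rewrite lin_derZl aE scalerA. Qed.

Lemma semi_invariantB f A B :
  semi_invariant f A -> semi_invariant f B -> semi_invariant f (A - B).
Proof.
by move=> fA fB; rewrite -scaleN1r; apply/semi_invariantD/semi_invariantZ.
Qed.

Lemma semi_invariant_lincomb f (I : finType) (c : I -> K) (A : I -> 'M[K]_n) :
  (forall i, semi_invariant f (A i)) -> semi_invariant f (\sum_i c i *: A i).
Proof.
move=> fA; apply: big_ind => [|B B'|i _]; first exact: semi_invariant0.
  exact: semi_invariantD.
exact: semi_invariantZ.
Qed.

(** A linear field sends a monomial to a combination of monomials of the same degree. *)
Lemma msize_lin_der A f : (msize (lin_der A f) <= msize f)%N.
Proof.
have -> : lin_der A f = \sum_(m <- msupp f) f@_m *: lin_der A 'X_[m].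
  rewrite {1}[f]mpolyE (big_morph _ (lin_derD A) (lin_der0 A)).
  by apply: eq_bigr => m _; rewrite lin_derZ.
rewrite big_seq.
apply: (big_ind (fun p => msize p <= msize f)%N) => [|p q pf qf|m mf].
  by rewrite msize0.
  by rewrite (leq_trans (msizeD_le _ _)) // geq_max pf.
rewrite (leq_trans (msizeZ_le _ _)) //.
apply: (@leq_trans (mdeg m).+1); last exact: msize_mdeg_lt.
rewrite /lin_der /vf_apply.
apply: (big_ind (fun p => msize p <= (mdeg m).+1)%N) => [|p q pf qf|i _].
- by rewrite msize0.
- by rewrite (leq_trans (msizeD_le _ _)) // geq_max pf.
rewrite mderivX; have [->|mi] := eqVneq (m i) 0%N.
  by rewrite scale0r mulr0 msize0.
rewrite -scalerAr (leq_trans (msizeZ_le _ _)) // mxE mulr_suml.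
apply: (big_ind (fun p => msize p <= (mdeg m).+1)%N) => [|p q pf qf|j _].
- by rewrite msize0.
- by rewrite (leq_trans (msizeD_le _ _)) // geq_max pf.
rewrite -scalerAl (leq_trans (msizeZ_le _ _)) // -mpolyXD msizeX ltnS.
rewrite mdegD mdeg1 -(mdeg1 i) -mdegD addmC submK //.
by rewrite lep1mP.
Qed.

(** The degree of the cofactor [h] adds to that of [f], but a linear field does not raise degrees;
    so [h] is constant. *)
Lemma semi_invariant_Der_log f A : f != 0 ->
  Der_log f (linear_vf A) -> semi_invariant f A.
Proof.
move=> f0 [h hE]; have [h0|h0] := eqVneq h 0.
  by exists 0; rewrite scale0r /lin_der hE h0 mul0r.
have := msize_lin_der A f; rewrite /lin_der hE msizeM //.
rewrite -msize_poly_eq0 -lt0n in h0.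
case: (msize h) h0 (@msize1_polyC _ _ h) => // k _ hC.
rewrite addSn /= -[X in (_ <= X)%N]add0n leq_add2r leqn0 => /eqP k0.
by exists (h@_0); rewrite /lin_der hE hC ?k0 // mul_mpolyC mcoeffC eqxx mulr1.
Qed.

Lemma mx_eq_cV (A B : 'M[K]_n) : (forall v : 'cV_n, A *m v = B *m v) -> A = B.
Proof.
move=> AB; apply/matrixP => i j.
by have /colP/(_ i) := AB (delta_mx j 0); rewrite -!colE !mxE.
Qed.

Definition const_vf (w : 'cV[K]_n) : 'cV[{mpoly K[n]}]_n := map_mx (@mpolyC n K) w.

End LogarithmicLinearFields.

(** * Consequences of generation by linear fields *)

Section FreeGeneration.
Variables (K : numClosedFieldType) (n m : nat).
Variables (f : {mpoly K[n]}) (A : 'I_m -> 'M[K]_n).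
Hypothesis f0 : f != 0.
Hypothesis genA : freely_generated_by (Der_log f) (fun k => linear_vf (A k)).

Lemma semi_invariant_gen k : semi_invariant f (A k).
Proof.
apply: semi_invariant_Der_log => //; rewrite genA.1.
exists (fun l => (l == k)%:R); rewrite (bigD1 k) //= big1 ?eqxx ?scale1r ?addr0 //.
by move=> l /negPf ->; rewrite scale0r.
Qed.

(** Expand the logarithmic field f w on the generators, evaluate the coefficients at [x] and divide
    by f(x). *)
Lemma semi_invariant_transitive (x w : 'cV[K]_n) :
  f.@[fun i => x i 0] != 0 -> exists2 B, semi_invariant f B & B *m x = w.
Proof.
move=> fx; have : Der_log f (f *: const_vf w).
  by exists (vf_apply (const_vf w) f); rewrite vf_applyZl mulrC.
rewrite genA.1 => -[c cE].
pose a k := (c k).@[fun i => x i 0] / f.@[fun i => x i 0].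
exists (\sum_k a k *: A k); first exact/semi_invariant_lincomb/semi_invariant_gen.
apply: (scalerI fx); apply/colP => i.
have fw : f.@[fun i => x i 0] * w i 0 =
    \sum_k (c k).@[fun i => x i 0] * (A k *m x) i 0.
  rewrite -[w i 0](mevalC (fun i => x i 0)) -mevalM.
  have -> : f * (w i 0)%:MP = (f *: const_vf w) i 0 by rewrite !mxE.
  rewrite cE summxE raddf_sum; apply: eq_bigr => k _ /=.
  by rewrite mxE mevalM meval_linear_vf.
rewrite [RHS]mxE fw mulmx_suml scaler_sumr summxE; apply: eq_bigr => k _.
by rewrite -scalemxAl scalerA [LHS]mxE; congr (_ * _); rewrite /a mulrC divfK.
Qed.

(** Evaluate at the origin an expansion of the constant field on the linear generators. *)
Lemma no_constant_Der_log (w : 'cV[K]_n) : vf_apply (const_vf w) f = 0 -> w = 0.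
Proof.
move=> wf; have : Der_log f (const_vf w) by exists 0; rewrite wf mul0r.
rewrite genA.1 => -[c cE]; apply/colP => i.
have /colP/(_ i)/(congr1 (meval (fun i => (0 : 'cV[K]_n) i 0))) := cE.
rewrite !mxE mevalC => ->; rewrite summxE raddf_sum big1 // => k _ /=.
by rewrite mxE mevalM meval_linear_vf mulmx0 mxE mulr0.
Qed.

End FreeGeneration.

(** * The algebra g when it is commutative *)

Section CommutingSemiInvariants.
Variables (K : numClosedFieldType) (n' : nat).
Notation n := n'.+1.
Variables (m : nat) (f : {mpoly K[n]}) (A : 'I_m -> 'M[K]_n).
Hypothesis f0 : f != 0.
Hypothesis genA : freely_generated_by (Der_log f) (fun k => linear_vf (A k)).
Hypothesis comm : forall B C, semi_invariant f B -> semi_invariant f C ->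
  B *m C = C *m B.

Notation ev x := (fun i => x i 0).

Lemma exists_nonroot : exists p : 'cV[K]_n, f.@[ev p] != 0.
Proof.
apply: contrapT => nf; case/negP: f0; apply/eqP; apply: mpoly_eq_meval => v.
by rewrite meval0; apply/eqP; apply: contraT => fv; case: nf; exists v.
Qed.

(** By transitivity the vectors B p fill the space, and M B p = B M p = 0. *)
Lemma commutant_eq0 (p : 'cV[K]_n) (M : 'M[K]_n) : f.@[ev p] != 0 ->
  (forall B, semi_invariant f B -> M *m B = B *m M) -> M *m p = 0 -> M = 0.
Proof.
move=> fp MB Mp; apply: mx_eq_cV => v.
have [B fB <-] := semi_invariant_transitive f0 genA v fp.
by rewrite mulmxA MB // -mulmxA Mp mulmx0 mul0mx.
Qed.

(** Some [E] in g agrees with [B *m C] at [p]; the difference commutes with g and kills [p], so it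
    vanishes. *)
Lemma semi_invariantM B C :
  semi_invariant f B -> semi_invariant f C -> semi_invariant f (B *m C).
Proof.
move=> fB fC; have [p fp] := exists_nonroot.
have [E fE Ep] := semi_invariant_transitive f0 genA (B *m C *m p) fp.
suff /subr0_eq -> : B *m C - E = 0 by [].
apply: (commutant_eq0 fp); last by rewrite mulmxBl Ep subrr.
move=> B' fB'; rewrite mulmxBl mulmxBr (comm fE fB').
by rewrite -mulmxA (comm fC fB') mulmxA (comm fB fB') mulmxA.
Qed.

Lemma semi_invariant1 : semi_invariant f 1%:M.
Proof.
have [p fp] := exists_nonroot.
have [E fE Ep] := semi_invariant_transitive f0 genA p fp.
suff /subr0_eq -> : 1%:M - E = 0 by [].
apply: (commutant_eq0 fp); last by rewrite mulmxBl Ep mul1mx subrr.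
by move=> B fB; rewrite mulmxBl mulmxBr mul1mx mulmx1 comm.
Qed.

Lemma semi_invariant_horner B s :
  semi_invariant f B -> semi_invariant f (horner_mx B s).
Proof.
move=> fB; elim/poly_ind: s => [|s c IHs].
  by rewrite raddf0; exact: semi_invariant0.
rewrite rmorphD rmorphM /= horner_mx_X horner_mx_C; apply: semi_invariantD.
  exact: semi_invariantM.
rewrite -[c%:M]mulmx1 mul_scalar_mx.
exact/semi_invariantZ/semi_invariant1.
Qed.

Lemma nilpotent_semi_invariant_eq0 N k :
  semi_invariant f N -> N ^+ k = 0 -> N = 0.
Proof.
move=> fN Nk; have [p fp] := exists_nonroot.
apply: (commutant_eq0 fp); first by move=> B; exact: comm.
apply: (no_constant_Der_log genA).
(* The factor [f] disposes of the points where f vanishes, at which transitivity says nothing. *)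
suff : f * vf_apply (const_vf (N *m p)) f = 0.
  by move=> /eqP; rewrite mulf_eq0 (negPf f0) => /eqP.
apply: mpoly_eq_meval => x; rewrite mevalM meval0.
have [->|fx] := eqVneq (f.@[ev x]) 0; first by rewrite mul0r.
(* At [x] the linear field of [N *m C] takes the value N p of the constant field. *)
have [C fC Cx] := semi_invariant_transitive f0 genA p fx.
have [lam NCf] := semi_invariantM fN fC.
have NCk : (N *m C) ^+ k = 0.
  by rewrite -[N *m C]/(N * C) exprMn_comm ?Nk ?mul0r //; exact: comm.
have := lin_der_nilpotent_eigen NCk NCf.
move=> /(congr1 (meval (ev x))); rewrite meval0 /lin_der !meval_vf_apply => NC0.
suff -> : \sum_i (const_vf (N *m p) i 0).@[ev x] * f^`M(i).@[ev x] = 0.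
  by rewrite mulr0.
apply: (etrans _ NC0).
by apply: eq_bigr => i _; rewrite meval_linear_vf mxE mevalC -mulmxA Cx.
Qed.

Lemma semi_invariant_diagonalizable B : semi_invariant f B -> diagonalizable B.
Proof.
move=> fB; have [s Sdiag [k Nk]] := jordan_chevalley B.
suff /subr0_eq -> : B - horner_mx B s = 0 by [].
apply: nilpotent_semi_invariant_eq0 Nk.
exact/semi_invariantB/semi_invariant_horner.
Qed.

(** Diagonalize simultaneously elements of g that send [p] to the standard basis. In the new
    coordinates, some diagonal element of g sends q = P p to the i-th basis vector; so no coordinate
    of [q] is zero and this element is a multiple of the i-th diagonal unit. *)
Lemma semi_invariant_torus : exists2 P : 'M[K]_n, P \in unitmx &
  forall i, semi_invariant f (invmx P *m delta_mx i i *m P).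
Proof.
have [p fp] := exists_nonroot.
have /choice[B BP] : forall i : 'I_n, exists B,
    semi_invariant f B /\ B *m p = delta_mx i 0.
  move=> i; have [B fB Bp] := semi_invariant_transitive f0 genA (delta_mx i 0) fp.
  by exists B.
have [P Pu /allP Pdiag] : codiagonalizable [seq B i | i <- enum 'I_n].
  apply/codiagonalizableP; split=> [_ _ /mapP[i _ ->] /mapP[j _ ->]|_ /mapP[i _ ->]].
    by apply: comm; [case: (BP i)|case: (BP j)].
  by apply: semi_invariant_diagonalizable; case: (BP i).
exists P => //.
pose q := P *m p.
have torus i : exists b : 'rV[K]_n,
    [/\ semi_invariant f (invmx P *m diag_mx b *m P) &
      forall j, b 0 j * q j 0 = (i == j)%:R].
  pose w : 'cV[K]_n := invmx P *m delta_mx i 0.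
  (* A combination of the [B j], so that the same [P] diagonalizes it; the coefficients are chosen
     to give E p = w. *)
  pose E : 'M[K]_n := \sum_j w j 0 *: B j.
  have Ediag : diagonalizable_for P E.
    change (is_true (is_diag_mx (conjmx P E))).
    rewrite conjumx //; apply/is_diag_mxP => k l kl.
    rewrite mulmx_sumr mulmx_suml summxE big1 // => j _.
    have : is_diag_mx (conjmx P (B j)) by apply: Pdiag; rewrite map_f ?mem_enum.
    rewrite conjumx // => /is_diag_mxP/(_ _ _ kl).
    by move=> Bj; rewrite -scalemxAr -scalemxAl mxE Bj mulr0.
  have /diagonalizable_forPex[b /(simmxRL Pu) bE] := Ediag.
  have EE : invmx P *m diag_mx b *m P = E.
    by rewrite bE !mulmxA mulVmx // mul1mx mulmxKV.
  exists b; split.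
    by rewrite EE; apply: semi_invariant_lincomb => j; case: (BP j).
  have Ep : E *m p = w.
    rewrite mulmx_suml [RHS]matrix_sum_delta; apply: eq_bigr => j _.
    by rewrite big_ord1 -scalemxAl (BP j).2.
  have /colP bq : diag_mx b *m q = delta_mx i 0.
    by rewrite bE /q mulmxA mulmxKV // -mulmxA Ep mulKVmx.
  by move=> j; have := bq j; rewrite mul_diag_mx !mxE eqxx andbT eq_sym.
have q0 i : q i 0 != 0.
  have [b [_ /(_ i)]] := torus i; rewrite eqxx => bq.
  by apply: contra_eq_neq bq => ->; rewrite mulr0 eq_sym oner_neq0.
move=> i; have [b [fb bq]] := torus i.
suff -> : delta_mx i i = q i 0 *: diag_mx b.
  by rewrite -scalemxAr -scalemxAl; exact: semi_invariantZ.
apply/matrixP => j k; rewrite [LHS]mxE [RHS]mxE [diag_mx _ _ _]mxE.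
have [<-|jk] := eqVneq j k.
  rewrite andbb mulr1n eq_sym; have := bq j.
  case: (eqVneq i j) => [<- <-|_ /eqP]; first by rewrite mulrC.
  by rewrite mulf_eq0 (negPf (q0 j)) orbF => /eqP ->; rewrite mulr0.
rewrite mulr0n mulr0; case: eqP => //= ji; case: eqP => // ki.
by rewrite ji ki eqxx in jk.
Qed.

Lemma zero_locus_normal_crossing : normal_crossing_divisor (zero_locus f).
Proof.
have [P Pu torus] := semi_invariant_torus; exists P => //.
pose f1 := lin_subst (invmx P) f.
have /choice[lam lamE] := torus.
have f1E (v : 'cV[K]_n) : f.@[ev v] = f1.@[ev (P *m v)].
  by rewrite meval_lin_subst mulKmx.
have f10 : f1 != 0.
  apply: contraNneq f0 => f10; apply/eqP; apply: mpoly_eq_meval => v.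
  by rewrite f1E f10 !meval0.
(* The i-th diagonal unit multiplies a monomial by its i-th exponent, so all monomials of [f1] share
   that exponent and [f1] is a single monomial. *)
have supp i m1 : m1 \in msupp f1 -> (m1 i)%:R = lam i.
  move=> mf; have : lin_der (delta_mx i i) f1 = lam i *: f1.
    rewrite (@lin_der_lin_subst _ _ _ (invmx P *m delta_mx i i *m P)).
      by rewrite lamE /f1 /lin_subst mmapZ mul_mpolyC.
    by rewrite mulmxK.
  have -> : delta_mx i i = diag_mx (delta_mx 0 i) :> 'M[K]_n.
    apply/matrixP => j k; rewrite !mxE eqxx /=.
    case: (eqVneq j k) => [->|jk]; first by rewrite andbb.
    rewrite mulr0n; case: eqP => //= ji; case: eqP => // ki.
    by rewrite ji ki eqxx in jk.
  move/(congr1 (mcoeff m1)); rewrite lin_der_diag mcoeffZ => /mulIf <-.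
    rewrite (bigD1 i) //= big1 ?addr0 => [|j ji]; rewrite mxE !eqxx /= ?mul1r //.
    by rewrite (negPf ji) mul0r.
  by rewrite -mcoeff_msupp.
pose m0 := mlead f1; have m0f : m0 \in msupp f1 by exact: mlead_supp.
have f1X : f1 = f1@_m0 *: 'X_[m0].
  apply/mpolyP => m1; rewrite mcoeffZ mcoeffX.
  have [<-|m01] := eqVneq m0 m1; first by rewrite mulr1.
  rewrite mulr0 memN_msupp_eq0 //; apply: contra m01 => m1f.
  apply/eqP/mnmP => i; apply/eqP; rewrite -(eqr_nat K).
  by rewrite (supp i _ m0f) (supp i _ m1f).
(* If x_i were missing, the field x_i d/dx_i would kill [f]; cancelling the linear form [l], which
   is x_i, the nonzero constant field [w] would kill [f] too. *)
have m0_neq0 i : m0 i != 0%N.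
  apply/negP => /eqP m0i; have := supp i _ m0f; rewrite m0i => lami.
  pose w : 'cV[K]_n := invmx P *m delta_mx i 0.
  have /(no_constant_Der_log genA) w0 : vf_apply (const_vf w) f = 0.
    pose l : {mpoly K[n]} := \sum_j P i j *: 'X_j.
    have lE (v : 'cV[K]_n) : l.@[ev v] = (P *m v) i 0.
      by rewrite raddf_sum mxE; apply: eq_bigr => j _; rewrite /= mevalZ mevalXU.
    have l0 : l != 0.
      apply/eqP => /(congr1 (meval (ev w))); rewrite lE mulKVmx // meval0 mxE.
      by rewrite !eqxx => /eqP; rewrite oner_eq0.
    suff : l * vf_apply (const_vf w) f = 0.
      by move=> /eqP; rewrite mulf_eq0 (negPf l0) => /eqP.
    apply: mpoly_eq_meval => x; rewrite mevalM meval0 lE.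
    have := lamE i; rewrite -lami scale0r => /(congr1 (meval (ev x))).
    rewrite meval0 /lin_der !meval_vf_apply => Pf0; apply: (etrans _ Pf0).
    rewrite mulr_sumr; apply: eq_bigr => j _; rewrite meval_linear_vf mulrA.
    congr (_ * _); rewrite [const_vf _ _ _]mxE mevalC -!mulmxA.
    rewrite -[delta_mx i i](mul_delta_mx (0 : 'I_1)) -!mulmxA -rowE.
    by rewrite mulmxA -/w [RHS]mxE big_ord1 [row _ _ _ _]mxE mulrC.
  move/(congr1 (mulmx P)): w0; rewrite mulKVmx // mulmx0 => /colP/(_ i).
  by rewrite !mxE !eqxx => /eqP; rewrite oner_eq0.
have c0 : f1@_m0 != 0 by rewrite -mcoeff_msupp.
apply/seteqP; split=> v; rewrite /zero_locus /= f1E f1X mevalZ mevalX => /eqP.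
  rewrite mulf_eq0 (negPf c0) /= => /prodf_eq0[i _ Pv].
  by apply/eqP/prodf_eq0; exists i => //; move: Pv; rewrite expf_eq0 => /andP[].
move/prodf_eq0 => [i _ /eqP Pv]; apply/eqP; rewrite mulf_eq0; apply/orP; right.
by apply/prodf_eq0; exists i => //; rewrite expf_eq0 lt0n m0_neq0 Pv /=.
Qed.

End CommutingSemiInvariants.

(** * Normal crossing divisors *)

Section NormalCrossing.
Variables (K : numClosedFieldType) (n' : nat).
Notation n := n'.+1.
Variable P : 'M[K]_n.
Hypothesis Pu : P \in unitmx.
Implicit Types (g h : {mpoly K[n]}) (delta : 'cV[{mpoly K[n]}]_n).

Notation ev x := (fun i => x i 0).
(* A component of a linear vector field is a linear form: ell i is the i-th
   coordinate x_i of the divisor, v |-> (P *m v) i 0. *)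
Notation ell i := (linear_vf P i 0).

Lemma vf_apply_linear_form delta (M : 'M[K]_n) i :
  vf_apply delta (linear_vf M i 0) = \sum_j M i j *: delta j 0.
Proof.
rewrite mxE (big_morph _ (vf_applyD delta) (vf_apply0 delta)).
by apply: eq_bigr => j _; rewrite vf_applyZ vf_applyXU.
Qed.

Lemma linear_form_eq0 (M : 'M[K]_n) i : linear_vf M i 0 = 0 -> forall k, M i k = 0.
Proof.
move=> M0 k; have := meval_linear_vf M (delta_mx k 0) i.
by rewrite M0 meval0 -colE mxE.
Qed.

Lemma mulmx_delta_diag m p (A : 'M[K]_(m, n)) (B : 'M[K]_(n, p)) i j k :
  (A *m delta_mx i i *m B) j k = A j i * B i k.
Proof.
rewrite -[delta_mx i i](mul_delta_mx (0 : 'I_1)) mulmxA -colE -mulmxA -rowE.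
by rewrite mxE big_ord1 !mxE.
Qed.

Definition nc_equation : {mpoly K[n]} := \prod_i ell i.

Definition nc_projection i : 'M[K]_n := 1%:M - invmx P *m delta_mx i i *m P.

(* Restriction to the hyperplane ell i = 0, pulled back by a projection onto
   it: its kernel is the ideal generated by ell i. *)
Definition nc_restriction i g := lin_subst (nc_projection i) g.

Lemma nc_restrictionM i : {morph nc_restriction i : g h / g * h}.
Proof. by move=> g h; rewrite /nc_restriction /lin_subst rmorphM. Qed.

Lemma nc_restrictionD i : {morph nc_restriction i : g h / g + h}.
Proof. by move=> g h; rewrite /nc_restriction /lin_subst mmapD. Qed.

Lemma nc_restrictionX i g k : nc_restriction i (g ^+ k) = nc_restriction i g ^+ k.
Proof. by rewrite /nc_restriction /lin_subst rmorphXn. Qed.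

Lemma linear_form_neq0 i : ell i != 0.
Proof.
apply/eqP => l0; have := meval_linear_vf P (invmx P *m delta_mx i 0) i.
by rewrite l0 mulKVmx // meval0 mxE !eqxx => /eqP; rewrite eq_sym oner_eq0.
Qed.

Lemma nc_restriction_form i k :
  nc_restriction i (ell k) = if k == i then 0 else ell k.
Proof.
apply: mpoly_eq_meval => v; rewrite meval_lin_subst meval_linear_vf.
have -> : P *m (nc_projection i *m v) = P *m v - delta_mx i i *m (P *m v).
  by rewrite mulmxBl mul1mx mulmxBr !mulmxA mulmxV // mul1mx.
rewrite [LHS]mxE [X in _ + X]mxE -[delta_mx i i]mul1mx mulmx_delta_diag.
rewrite [1%:M _ _]mxE; case: eqVneq => [->|ki].
  by rewrite mulr1n mul1r subrr meval0.
by rewrite mulr0n mul0r subr0 meval_linear_vf.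
Qed.

(** A variable and its pullback differ by a constant multiple of [ell i], and congruence modulo
    [ell i] respects sums and products. *)
Lemma nc_restriction_mod i g : exists h, g = nc_restriction i g + h * ell i.
Proof.
elim/mpoly_ring_ind: g => [c|j|p q [hp IHp] [hq IHq]|p q [hp IHp] [hq IHq]].
- by exists 0; rewrite mul0r addr0 /nc_restriction /lin_subst mmapC.
- exists (invmx P j i)%:MP; apply: mpoly_eq_meval => v.
  rewrite mevalD meval_lin_subst mevalM mevalC meval_linear_vf !mevalXU.
  rewrite mulmxBl mul1mx [X in X + _]mxE [X in _ + X + _]mxE.
  by rewrite -[_ *m P *m v]mulmxA mulmx_delta_diag subrK.
- exists (hp + hq); rewrite nc_restrictionD {1}IHp {1}IHq.
  by rewrite mulrDl addrACA.
exists (hp * q + nc_restriction i p * hq); rewrite nc_restrictionM mulrDl addrCA.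
rewrite -[nc_restriction i p * hq * _]mulrA -mulrDr -IHq [hp * _ * _]mulrAC.
by rewrite -mulrDl [hp * _ + _]addrC -IHp.
Qed.

(** Divide by one form at a time, along a duplicate-free list: if g = h [ell i] and j differs from
    i, then [ell i] restricts to a nonzero form on the hyperplane of j, so [h] restricts to zero
    there. *)
Lemma nc_dvd g : (forall i, nc_restriction i g = 0) -> mdvd nc_equation g.
Proof.
move=> g0; rewrite /nc_equation; have := index_enum_uniq 'I_n.
have : forall i, i \in index_enum 'I_n -> nc_restriction i g = 0 by [].
elim: (index_enum 'I_n) g {g0} => [|i s IHs] g gs /=.
  by exists g; rewrite big_nil mulr1.
move=> /andP[iNs us]; have [h gE] := nc_restriction_mod i g.
rewrite gs ?mem_head // add0r in gE.
have [j js|//|h' hE] := IHs h; last first.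
  by exists h'; rewrite big_cons mulrCA -hE mulrC.
have := gs j; rewrite inE js orbT gE nc_restrictionM nc_restriction_form.
have -> : (i == j) = false by apply: contraNF iNs => /eqP ->.
move=> /(_ isT)/eqP; rewrite mulf_eq0 (negPf (linear_form_neq0 i)) orbF.
by move/eqP.
Qed.

Lemma nc_equation_split i : nc_equation = ell i * \prod_(j | j != i) ell j.
Proof. by rewrite /nc_equation (bigD1 i). Qed.

Lemma nc_restriction_equation i : nc_restriction i nc_equation = 0.
Proof.
by rewrite (nc_equation_split i) nc_restrictionM nc_restriction_form eqxx mul0r.
Qed.

Lemma meval_nc_equation (v : 'cV[K]_n) :
  nc_equation.@[ev v] = \prod_i (P *m v) i 0.
Proof.
by rewrite rmorph_prod; apply: eq_bigr => i _; exact: meval_linear_vf.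
Qed.

Lemma nc_zero_locus : zero_locus nc_equation = [set v | \prod_i (P *m v) i 0 = 0].
Proof. by apply/seteqP; split=> v; rewrite /zero_locus /= meval_nc_equation. Qed.

(** The equation takes the values 0 and 1, so it is not constant. It is reduced because the
    restrictions take values in a domain and jointly detect divisibility. *)
Lemma nc_reduced_equation :
  reduced_equation [set v | \prod_i (P *m v) i 0 = 0] nc_equation.
Proof.
split; last by rewrite nc_zero_locus.
  rewrite ltnNge; apply/negP => /msize1_polyC.
  set c := mcoeff _ _ => fC.
  have := meval_nc_equation (invmx P *m const_mx 1).
  have := meval_nc_equation 0.
  rewrite fC !mevalC mulKVmx // mulmx0 (bigD1 ord0) //= mxE mul0r => ->.
  rewrite big1 => [/eqP|i _]; last by rewrite mxE.
  by rewrite eq_sym oner_eq0.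
move=> g k [h gE]; apply: nc_dvd => i; apply/eqP.
have /eqP := congr1 (nc_restriction i) gE.
by rewrite nc_restrictionX nc_restrictionM nc_restriction_equation mulr0
  expf_eq0 => /andP[].
Qed.

(** Restricted to the hyperplane of i, the Leibniz expansion keeps only the term that differentiates
    [ell i], and its cofactor is nonzero there. *)
Lemma nc_Der_logP delta : Der_log nc_equation delta <->
  forall i, nc_restriction i (vf_apply delta (ell i)) = 0.
Proof.
have rE i : nc_restriction i (vf_apply delta nc_equation) =
    nc_restriction i (vf_apply delta (ell i)) * \prod_(j | j != i) ell j.
  rewrite {1}(nc_equation_split i) vf_applyM nc_restrictionD !nc_restrictionM.
  rewrite nc_restriction_form eqxx mul0r addr0; congr (_ * _).
  (* At exponent 0, [nc_restrictionX] says that 1 restricts to 1. *)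
  rewrite (big_morph _ (nc_restrictionM i) (nc_restrictionX i 1 0)).
  by apply: eq_bigr => j /negPf ji; rewrite nc_restriction_form ji.
split=> [[h hE] i|d0]; last first.
  by apply: nc_dvd => i; rewrite rE d0 mul0r.
have := rE i; rewrite hE nc_restrictionM nc_restriction_equation mulr0.
move=> /esym/eqP; rewrite mulf_eq0 => /orP[/eqP //|/eqP p0].
by move/eqP: p0 => /prodf_eq0[j _ l0]; have := linear_form_neq0 j; rewrite l0.
Qed.

(** In the coordinates of the divisor this is the field x_i d/dx_i. *)
Definition nc_field i : 'M[K]_n := invmx P *m delta_mx i i *m P.

Lemma linear_vf_nc_field i j : linear_vf (nc_field i) j 0 = invmx P j i *: ell i.
Proof.
apply: mpoly_eq_meval => v; rewrite mevalZ !meval_linear_vf -mulmxA.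
by rewrite mulmx_delta_diag.
Qed.

(** The field of index i kills the other coordinates, so evaluating on [ell k] isolates [c k].
    Freeness follows, and the coefficients of a logarithmic field are its values on the coordinates
    divided by these coordinates. *)
Lemma vf_apply_nc_lincomb (c : 'I_n -> {mpoly K[n]}) k :
  vf_apply (\sum_i c i *: linear_vf (nc_field i)) (ell k) = c k * ell k.
Proof.
have inv i : \sum_j P k j * invmx P j i = (k == i)%:R.
  by have /matrixP/(_ k i) := mulmxV Pu; rewrite !mxE.
transitivity (\sum_i (\sum_j P k j * invmx P j i) *: (c i * ell i)).
  rewrite vf_apply_linear_form.
  under eq_bigr => j _ do rewrite summxE scaler_sumr.
  rewrite exchange_big; apply: eq_bigr => i _; rewrite scaler_suml.
  apply: eq_bigr => j _; rewrite [X in _ *: X = _]mxE linear_vf_nc_field.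
  by rewrite -scalerAr scalerA.
rewrite (bigD1 k) //= inv eqxx scale1r big1 ?addr0 // => i ik.
by rewrite inv eq_sym (negPf ik) scale0r.
Qed.

Lemma nc_linear_free_divisor :
  linear_free_divisor [set v | \prod_i (P *m v) i 0 = 0].
Proof.
exists nc_equation; first exact: nc_reduced_equation.
exists n, nc_field; split=> [|c c0 k]; last first.
  have := vf_apply_nc_lincomb c k; rewrite c0 vf_apply_linear_form big1 => [|j _].
    move=> /esym/eqP; rewrite mulf_eq0 (negPf (linear_form_neq0 k)) orbF.
    by move/eqP.
  by rewrite mxE scaler0.
apply/seteqP; split=> [delta /nc_Der_logP d0|_ [c ->]]; last first.
  apply/nc_Der_logP => i; rewrite vf_apply_nc_lincomb nc_restrictionM.
  by rewrite nc_restriction_form eqxx mulr0.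
have /choice[c cE] : forall i, exists h, vf_apply delta (ell i) = h * ell i.
  move=> i; have [h hE] := nc_restriction_mod i (vf_apply delta (ell i)).
  by exists h; rewrite {1}hE d0 add0r.
exists c; apply/colP => j; rewrite summxE.
have <- : vf_apply delta 'X_j = delta j 0 by exact: vf_applyXU.
have -> : 'X_j = \sum_i invmx P j i *: ell i.
  apply: mpoly_eq_meval => v; rewrite mevalXU raddf_sum -{1}[v](mulKmx Pu) mxE.
  by apply: eq_bigr => i _; rewrite /= mevalZ meval_linear_vf.
rewrite (big_morph _ (vf_applyD delta) (vf_apply0 delta)); apply: eq_bigr => i _.
by rewrite vf_applyZ cE [RHS]mxE linear_vf_nc_field scalerAr.
Qed.

(** * The diagonal torus as associated group *)

Definition nc_torus : set 'M[K]_n :=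
  [set A | exists2 d : 'rV[K]_n, forall i, d 0 i != 0 &
           A = invmx P *m diag_mx d *m P].

Lemma nc_torus_stabilizer :
  nc_torus `<=` set_stabilizer [set v | \prod_i (P *m v) i 0 = 0].
Proof.
move=> _ [d d0 ->]; split=> [|v].
  rewrite !unitmx_mul unitmx_inv Pu andbT /= unitmxE det_diag unitfE.
  by apply/prodf_neq0 => i _.
rewrite /= -!mulmxA mulKVmx //.
under eq_bigr => i _ do rewrite mul_diag_mx mxE.
rewrite big_split /=; split=> [/eqP|->]; last by rewrite mulr0.
rewrite mulf_eq0 => /orP[/prodf_eq0[i _ di]|/eqP //].
by have := d0 i; rewrite di.
Qed.

Lemma nc_torusM A B : nc_torus A -> nc_torus B -> nc_torus (A *m B).
Proof.
move=> [d d0 ->] [e e0 ->]; exists (\row_i (d 0 i * e 0 i)) => [i|].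
  by rewrite mxE mulf_neq0.
by rewrite -mulmx_diag !mulmxA mulmxK.
Qed.

Lemma nc_torus1 : nc_torus 1%:M.
Proof.
exists (const_mx 1) => [i|]; first by rewrite mxE oner_neq0.
by rewrite diag_const_mx mulmx1 mulVmx.
Qed.

Lemma nc_torus_GL_subgroup : GL_subgroup nc_torus.
Proof.
split; [by move=> A /nc_torus_stabilizer[]|exact: nc_torus1|exact: nc_torusM|].
move=> A TA; have [Au _] := nc_torus_stabilizer TA.
case: TA Au => d d0 -> Au; exists (\row_i (d 0 i)^-1) => [i|].
  by rewrite mxE invr_eq0.
apply: (can_inj (mulmxK Au)); rewrite mulVmx // !mulmxA mulmxK //.
rewrite -[X in X *m P]mulmxA mulmx_diag.
have -> : \row_j ((\row_i (d 0 i)^-1) 0 j * d 0 j) = const_mx 1.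
  by apply/rowP => i; rewrite !mxE mulVf.
by rewrite diag_const_mx mulmx1 mulVmx.
Qed.

(** [A] maps the hyperplane of i into the divisor, so a product of linear forms vanishes on that
    hyperplane; one factor vanishes there, and it gives the row [j]. *)
Lemma stabilizer_monomial (A : 'M[K]_n) i :
  set_stabilizer [set v | \prod_i (P *m v) i 0 = 0] A ->
  exists j, forall k, k != i -> (P *m A *m invmx P) j k = 0.
Proof.
move=> [_ AD]; set B := P *m A *m invmx P.
pose Bi := B *m (1%:M - delta_mx i i).
have /eqP/prodf_eq0[j _ /eqP/linear_form_eq0 Bj] : \prod_j linear_vf Bi j 0 = 0.
  apply: mpoly_eq_meval => v; rewrite meval0 rmorph_prod.
  pose v' := (1%:M - delta_mx i i) *m v.
  have v'i : v' i 0 = 0.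
    rewrite /v' mulmxBl mul1mx mxE [X in _ + X]mxE -[delta_mx i i]mul1mx.
    by rewrite mulmx_delta_diag mxE eqxx mul1r subrr.
  have /AD : [set v | \prod_i (P *m v) i 0 = 0] (invmx P *m v').
    by rewrite /= mulKVmx // (bigD1 i) //= v'i mul0r.
  move=> /= E; apply: (etrans _ E); apply: eq_bigr => j _.
  by rewrite /= meval_linear_vf /Bi /v' /B !mulmxA.
exists j => k ki; have := Bj k; rewrite /Bi mulmxBr mulmx1 mxE [X in _ + X]mxE.
rewrite -[B *m _]mulmx1 mulmx_delta_diag [1%:M _ _]mxE eq_sym (negPf ki).
by rewrite mulr0n mulr0 subr0.
Qed.

Lemma connected_stabilizer_nc_torus (H : set 'M[K]_n) :
  connected_GL_subgroup_preserving [set v | \prod_i (P *m v) i 0 = 0] H ->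
  H `<=` nc_torus.
Proof.
move=> [Hgr Hc Hpres]; have HS := preserves_stabilizer Hgr Hpres.
pose c (A : 'M[K]_n) := P *m A *m invmx P.
have c_cont i j : continuous (fun A => c A i j).
  apply: continuous_coord; apply: continuous_mulmx; last exact: cst_continuous.
  apply: continuous_mulmx; first exact: cst_continuous.
  by move=> M; apply: cvg_id.
have cu A : H A -> c A \in unitmx.
  by move=> /HS[Au _]; rewrite /c !unitmx_mul unitmx_inv Pu Au.
pose H0 := H `&` [set A | forall i j, i != j -> c A i j = 0].
have H0diag A : H0 A -> c A = diag_mx (\row_i c A i i).
  move=> [HA cA]; apply/matrixP => i j; rewrite [RHS]mxE.
  have [<-|ij] := eqVneq i j; first by rewrite mulr1n [RHS]mxE.
  by rewrite cA // mulr0n.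
have H0diag_neq0 A : H0 A -> forall i, c A i i != 0.
  move=> H0A; have := cu _ H0A.1; rewrite {1}H0diag // unitmxE unitfE det_diag.
  by move/prodf_neq0 => + i => /(_ i isT); rewrite [X in X != 0]mxE.
suff <- : H0 = H.
  move=> A H0A; exists (\row_i c A i i) => [i|]; first by rewrite mxE H0diag_neq0.
  by rewrite -H0diag // /c !mulmxA mulVmx // mul1mx mulmxKV.
apply: Hc.
- have [_ H1 _ _] := Hgr; exists 1%:M; split=> // i j ij.
  by rewrite /c mulmx1 mulmxV // mxE (negPf ij).
(* Openness: among these matrices, being diagonal amounts to having no zero on the diagonal. *)
- exists (~` [set A | \prod_i c A i i = 0]).
    apply: closed_openC; apply: closed_zero_set.
    elim: (index_enum _) => [|i s IHs] t.
      by under eq_fun do rewrite big_nil; exact: cst_continuous.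
    under eq_fun do rewrite big_cons.
    by apply: continuousM; [exact: c_cont|exact: IHs].
  apply/seteqP; split=> A [HA cA]; split=> //.
    by move=> /eqP /prodf_eq0[i _]; apply/negP/H0diag_neq0.
  move=> i j ij; have [k kP] := stabilizer_monomial i (HS _ HA).
  (* Row [k] is supported in column [i]; were they distinct, the k-th diagonal entry would
     vanish. *)
  have ki : k = i.
    apply/eqP/contraT => ki; case: cA => /=.
    by apply/eqP/prodf_eq0; exists k => //; rewrite /c kP.
  by rewrite /c -{1}ki kP // eq_sym.
(* Closedness: the off-diagonal entries vanish. *)
- exists (\bigcap_(ij in [set ij : 'I_n * 'I_n | ij.1 != ij.2])
    [set A | c A ij.1 ij.2 = 0]).
    by apply: closed_bigI => ij _; exact: closed_zero_set.
  apply/seteqP; split=> A [HA cA]; split=> //; first by move=> [i j] /= /cA.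
  by move=> i j ij; exact: (cA (i, j)).
Qed.

Variables (R : realType) (iota : {rmorphism R -> K}).
Hypothesis iota_cont : continuous (iota : R -> K).
Hypothesis iota_ge0 : forall x : R, 0 <= x -> 0 <= iota x.

(* sqrtC z is never a negative real number, so the segment from 1 to sqrtC z
   avoids 0, and its square is a path from 1 to z in the nonzero numbers. *)
Lemma sqrtC_segment_neq0 (z : K) (x : K) : z != 0 -> 0 <= x -> x <= 1 ->
  (1 - x) + x * sqrtC z != 0.
Proof.
move=> z0 x0 x1; apply/eqP => E.
have xn0 : x != 0.
  by apply: contra_eq_neq E => ->; rewrite mul0r subr0 addr0 oner_neq0.
have sE : sqrtC z = - ((1 - x) / x).
  apply: (mulfI xn0); rewrite mulrN [x * (_ / _)]mulrC divfK //.
  by apply/eqP; rewrite -addr_eq0 addrC E.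
have sle : sqrtC z <= 0 by rewrite sE oppr_le0 divr_ge0 // subr_ge0.
have zge : 0 <= z by rewrite -(sqrtCK z) -sqrrN exprn_ge0 // oppr_ge0.
by move: z0; rewrite -sqrtC_eq0 eq_le sle sqrtC_ge0 zge.
Qed.

(** The torus is the union of paths [F d] that start at 1 and end at its points. *)
Lemma nc_torus_connected : connected nc_torus.
Proof.
pose F (d : 'rV[K]_n) (t : R) := invmx P *m
  diag_mx (\row_i ((1 - iota t) + iota t * sqrtC (d 0 i)) ^+ 2) *m P.
have -> : nc_torus = \bigcup_(d in [set d : 'rV[K]_n | forall i, d 0 i != 0])
    (F d @` `[0, 1]).
  apply/seteqP; split=> [_ [d d0 ->]|_ [d d0 [t + <-]]].
    exists d => //; exists 1; first by rewrite /= in_itv /= ler01 lexx.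
    rewrite /F rmorph1; congr (_ *m diag_mx _ *m _); apply/rowP => i.
    by rewrite mxE subrr add0r mul1r sqrtCK.
  rewrite /= in_itv /= => /andP[t0 t1]; eexists; last by [].
  move=> i; rewrite mxE expf_neq0 // sqrtC_segment_neq0 ?iota_ge0 //.
  by rewrite -subr_ge0 -(rmorph1 iota) -rmorphB iota_ge0 // subr_ge0.
apply: bigcup_connected.
  exists 1%:M => d _; exists 0; first by rewrite /= in_itv /= lexx ler01.
  rewrite /F rmorph0.
  have -> : \row_i (1 - 0 + 0 * sqrtC (d 0 i)) ^+ 2 = const_mx 1.
    by apply/rowP => i; rewrite !mxE subr0 mul0r addr0 expr1n.
  by rewrite diag_const_mx mulmx1 mulVmx.
move=> d _; apply: connected_continuous_connected; first exact: segment_connected.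
apply: continuous_subspaceT.
apply: continuous_mulmx; last exact: cst_continuous.
apply: continuous_mulmx; first exact: cst_continuous.
apply: continuous_mx => i j.
have -> : (fun t => (diag_mx (\row_i ((1 - iota t) + iota t * sqrtC (d 0 i)) ^+ 2)
    : 'M[K]_n) i j) =
  (fun t => (i == j)%:R * ((1 - iota t) + iota t * sqrtC (d 0 i)) ^+ 2).
  by apply/funext => t; rewrite !mxE mulr_natl.
move=> t; apply: (@continuousM K R (cst _)
  (fun t => ((1 - iota t) + iota t * sqrtC (d 0 i)) ^+ 2)).
  exact: cst_continuous.
apply: continuous_expr => {}t.
apply: (@continuousD K K R (fun t => 1 - iota t) (fun t => iota t * sqrtC (d 0 i))).
  apply: (@continuousB K K R (cst 1) (iota : R -> K)); first exact: cst_continuous.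
  exact: iota_cont.
apply: (@continuousM K R (iota : R -> K) (cst _)); first exact: iota_cont.
exact: cst_continuous.
Qed.

Lemma nc_abelian_divisor : abelian_divisor [set v | \prod_i (P *m v) i 0 = 0].
Proof.
exists nc_torus.
  split; last exact: connected_stabilizer_nc_torus.
  split; [exact: nc_torus_GL_subgroup|exact: nc_torus_connected|].
  exact/stabilizer_preserves/nc_torus_stabilizer.
move=> _ _ [d _ ->] [e _ ->]; rewrite !mulmxA.
rewrite -![invmx P *m _ *m P *m invmx P]mulmxA mulmxV // !mulmx1.
by rewrite -[invmx P *m _ *m _]mulmxA diag_mxC mulmxA.
Qed.

End NormalCrossing.

(** * Assembly, and specialization to the complex numbers *)

(** Commutativity passes from G to g by using [commutant_associated_group] twice: elements of G
    commute with g, and therefore elements of g commute with each other. *)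
Lemma abelian_lfd_normal_crossing (K : numClosedFieldType) (R : realType)
    (iota : {rmorphism R -> K}) (re im : {additive K -> R}) (n' : nat)
    (D : set 'cV[K]_n'.+1) :
  continuous (iota : R -> K) ->
  (forall x y, re x = re y -> im x = im y -> x = y) ->
  linear_free_divisor D -> abelian_divisor D -> normal_crossing_divisor D.
Proof.
move=> iota_cont reim_inj [f [f1 _ ->] [m [A genA]]] [G Gf Gab].
have f0 : f != 0 by rewrite -msize_poly_eq0 -lt0n ltnW.
apply: (zero_locus_normal_crossing f0 genA) => B C [b fB] [c fC].
apply: (commutant_associated_group iota_cont Gf reim_inj fC) => g Gg.
apply/esym/(commutant_associated_group iota_cont Gf reim_inj fB) => h Gh.
exact: Gab.
Qed.

Theorem theorem2p12 (R : realType) (n : nat) (hn : (0 < n)%N)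
    (D : set 'cV[R[i]%C]_n) :
  (linear_free_divisor D /\ abelian_divisor D) <-> normal_crossing_divisor D.
Proof.
case: n hn D => // n _ D.
have reim_inj (x y : R[i]%C) : complex.Re x = complex.Re y ->
    complex.Im x = complex.Im y -> x = y.
  by case: x y => [a b] [c d] /= -> ->.
have iota_cont := @continuous_real_complex R.
have iota_ge0 (x : R) : 0 <= x -> (0 : R[i]%C) <= (x%:C)%C.
  by rewrite lecR.
split=> [[Dlf Dab]|[P Pu ->]].
  exact: (abelian_lfd_normal_crossing (iota := real_complex R)
    (re := @complex.Re R) (im := @complex.Im R) iota_cont reim_inj Dlf Dab).
split; first exact: nc_linear_free_divisor.
exact: (nc_abelian_divisor Pu (iota := real_complex R) iota_cont iota_ge0).
Qed.
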